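(* Let $n\ge2$, let $P$ be a positive regular polynomial $n$-tuple, let $m\in\mathbb N^n$, and let $\mathscr M_z$ be the multiplication $n$-tuple on $\mathscr H^2_m(\triangle^n_P)$. Then the joint kernel $$\ker(\mathscr M_z^*-\overline w)=\begin{cases}\{\eta\,\mathscr K_{P,m}(\cdot,w):\eta\in\mathbb C\} & \text{if } w\in\triangle^n_P,\\[2pt] \bigvee\{e_\alpha:\alpha\in\mathbb Z_+^n,\ \alpha_n=0\} & \text{if } w=0.\end{cases}$$ Moreover, if $w\in\mathbb C\times\mathbb C_*^{n-1}$, then every $f\in\ker(\mathscr M_z^*-\overline w)$ has the form $$f(z)=\langle f,e_0\rangle\ \prod_{k=2}^n\overline w_k\ \sum_{\alpha\in\mathbb Z_+^n}\overline{e_\alpha(w)}\,e_\alpha(z),\qquad z\in\triangle^n_P,$$ where $e_\alpha$ is extended by its defining formula to $\mathbb C\times\mathbb C_*^{n-1}$.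
   Context: $\mathbb N$ = positive integers, $\mathbb Z_+$ = nonnegative integers, $\mathbb C_*=\mathbb C\setminus\{0\}$, $z\diamond w=(z_1w_1,\ldots,z_nw_n)$, and $\overline z$ is the entrywise conjugate. For $n\ge2$ let $\varphi(z)=\big(\frac{z_1}{z_2},\ldots,\frac{z_{n-1}}{z_n},z_n\big)$ for $z\in\mathbb C\times\mathbb C_*^{n-1}$. A polynomial $n$-tuple $P=(P_1,\ldots,P_n)$ in $\mathbb C[z_1,\ldots,z_n]$ is positive regular if for each $j$, $P_j$ has nonnegative coefficients and $P_j(z)=a_jz_j+\sum_{k=2}^{N_j}Q_{jk}(z)$ with $a_j>0$ and $Q_{jk}$ homogeneous of degree $k$. The $P$-triangle is $\triangle^n_P=\{z\in\mathbb C\times\mathbb C_*^{n-1}: P_j(\varphi(z)\diamond\overline{\varphi(z)})<1,\ j=1,\ldots,n\}$. For $m\in\mathbb N^n$, $\mathscr H^2_m(\triangle^n_P)$ is the reproducing kernel Hilbert space of holomorphic functions on $\triangle^n_P$ with kernel $$\mathscr K_{P,m}(z,w)=\prod_{j=2}^n\frac1{z_j\overline w_j}\prod_{j=1}^n\frac1{\big(1-P_j(\varphi(z)\diamond\overline{\varphi(w)})\big)^{m_j}}.$$ Each $z_j$ is a multiplier of this space; $\mathscr M_{z_j}$ is the bounded operator of multiplication by $z_j$, and $\mathscr M_z=(\mathscr M_{z_1},\ldots,\mathscr M_{z_n})$. Define $A_{P,m}(\alpha)>0$, $\alpha\in\mathbb Z_+^n$, by the power series expansion near the origin $\prod_{j=1}^n(1-P_j(x))^{-m_j}=\sum_{\alpha\in\mathbb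 Z_+^n}A_{P,m}(\alpha)x^\alpha$, and set $e_\alpha(z)=\sqrt{A_{P,m}(\alpha)}\,\varphi(z)^\alpha/\prod_{j=2}^nz_j$; then $\{e_\alpha\}_{\alpha\in\mathbb Z_+^n}$ is an orthonormal basis of $\mathscr H^2_m(\triangle^n_P)$. Here $\ker(\mathscr M_z^*-\overline w)=\bigcap_{j=1}^n\ker(\mathscr M_{z_j}^*-\overline w_j)$, and $\bigvee$ denotes closed linear span. *)

(* Defs.v *)
From HB Require Import structures.
From mathcomp Require Import all_boot all_order all_algebra finmap complex.
From mathcomp Require Import all_classical all_reals all_analysis summability.
(* The notations of mpoly are incompatible with those of the analysis library. *)
From mathcomp.multinomials Require Import -(notations) mpoly.

Set Implicit Arguments.
Unset Strict Implicit.
Unset Printing Implicit Defensive.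

Import Order.TTheory GRing.Theory Num.Theory numFieldNormedType.Exports.

Local Open Scope classical_set_scope.
Local Open Scope ring_scope.

(* Throughout, ['rV[R[i]]_n] is C^n, and coordinates are numbered from 0: the
   coordinate z_j of the text is [z 0 i] with [val i = j - 1].  In particular
   [0 < j] below selects the coordinates z_2, ..., z_n.  The order on [R[i]] is
   the partial order of a [numClosedFieldType]: [0 <= c] and [c < 1] entail that
   [c] is real. *)

Section Triangle.
Context {R : realType} {n : nat}.
Local Notation C := (R[i]%C).
Local Notation V := 'rV[C]_n.

(* C x C_*^(n-1) *)
Definition punctured : set V :=
  [set z | forall j : 'I_n, (0 < j)%N -> z 0 j != 0].

Definition phi (z : V) : V :=
  \row_j (if insub j.+1 is Some k then z 0 j / z 0 (k : 'I_n) else z 0 j).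

(* the entrywise product of phi(z) and conj(phi(w)) *)
Definition phi2 (z w : V) : V := \row_j (phi z 0 j * (phi w 0 j)^*).

Definition monomial (x : V) (alpha : multinom n) : C :=
  \prod_j x 0 j ^+ alpha j.

Definition prod_tail (z : V) : C := \prod_(j < n | (0 < j)%N) z 0 j.

Definition peval (p : mpoly n C) (x : V) : C := meval (fun j => x 0 j) p.

Definition positive_regular (P : 'I_n -> mpoly n C) : Prop :=
  forall j, (forall alpha, 0 <= mcoeff alpha (P j)) /\
    exists (a : C) (N : nat) (Q : nat -> mpoly n C),
      [/\ 0 < a,
          forall k, (2 <= k <= N)%N -> Q k \is ishomog1 k mdeg &
          P j = a *: mpolyX C (mnm1 j) + \sum_(2 <= k < N.+1) Q k].

Variables (P : 'I_n -> mpoly n C) (m : 'I_n -> nat).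

Definition triangle : set V :=
  [set z | punctured z /\ forall j, peval (P j) (phi2 z z) < 1].

Definition tri_kernel (z w : V) : C :=
  \prod_(j < n | (0 < j)%N) (z 0 j * (w 0 j)^*)^-1 *
  \prod_j ((1 - peval (P j) (phi2 z w)) ^+ m j)^-1.

(* The coefficients of the power series expansion near the origin, the series
   over all multi-indices being summed unconditionally. *)
Definition Acoef : multinom n -> C :=
  xget (fun=> 0) [set A | \forall x \near (0 : 'rV[C^o]_n),
    partial_sum (fun alpha => A alpha * monomial x alpha : C^o) @ totally -->
      (\prod_j ((1 - peval (P j) x) ^+ m j)^-1 : C^o)].

Definition efun (alpha : multinom n) (z : V) : C :=
  sqrtC (Acoef alpha) * monomial (phi z) alpha / prod_tail z.

End Triangle.

Section HilbertSpace.
Context {R : realType} {H : completeNormedModType R[i]%C}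
  (ip : {dot H for Num.conj}).
Local Notation C := (R[i]%C).

(* The inner product of [{dot H for Num.conj}] is linear in its first argument
   and conjugate linear in the second. *)
Definition hilbert : Prop := forall f, ip f f = `|f| ^+ 2.

Definition span (A : set H) : set H :=
  [set v | exists2 s : seq (C * H), (forall p, p \in s -> A p.2) &
                                    v = \sum_(p <- s) p.1 *: p.2].

Definition closed_span (A : set H) : set H := closure (span A).

(* Meaningful when [T] is a bounded operator: the vector representing
   [f |-> ip (T f) g] is then unique and exists by Riesz. *)
Definition adjoint (T : H -> H) (g : H) : H :=
  xget 0 [set h | forall f, ip (T f) g = ip f h].

Definition ker (T : H -> H) : set H := [set f | T f = 0].

End HilbertSpace.

Section RKHS.
Context {R : realType} {n : nat} {H : completeNormedModType R[i]%C}
  (D : set 'rV[R[i]%C]_n).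
Local Notation C := (R[i]%C).
Local Notation V := 'rV[C]_n.
Implicit Type ev : H -> V -> C.

(* [H] is, through [ev], a space of functions on [D]: the element [f] is the
   function [ev f] restricted to [D]; values of [ev f] outside [D] are
   irrelevant. *)
Record is_rkhs (K : V -> V -> C) (ip : {dot H for Num.conj}) ev : Prop := {
  rkhs_hilbert : hilbert ip;
  rkhs_linear : forall (a : C) f g z, D z ->
    ev (a *: f + g) z = a * ev f z + ev g z;
  rkhs_inj : forall f g, (forall z, D z -> ev f z = ev g z) -> f = g;
  rkhs_holomorphic : forall f z, D z -> differentiable (ev f : 'rV[C^o]_n -> C^o) (z : 'rV[C^o]_n);
  rkhs_reproducing : forall w, D w ->
    exists2 k : H, (forall z, D z -> ev k z = K z w) &
                   forall f, ev f w = ip f k }.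

(* The element of [H] which is the function [g] on [D]; it is unique by
   [rkhs_inj]. *)
Definition elt ev (g : V -> C) : H :=
  xget 0 [set h | forall z, D z -> ev h z = g z].

Definition mulop ev (j : 'I_n) (f : H) : H := elt ev (fun z => z 0 j * ev f z).

(* ker (M_z^* - conj w) *)
Definition joint_ker (ip : {dot H for Num.conj}) ev (w : V) : set H :=
  \bigcap_(j in [set: 'I_n])
    ker (fun f => adjoint ip (mulop ev j) f - (w 0 j)^* *: f).

End RKHS.

(* Main.v *)
(* In the coordinates x = phi(z) the multiplication by z_j is a weighted shift:
   z_j e_alpha is a multiple of e_(alpha + eps_j + ... + eps_n).  Hence
   M_z^* f = conj(w) f is a recurrence for the numbers <f, e_alpha>.  If
   w_2, ..., w_n are nonzero, it determines all of them from <f, e_0>; if w = 0,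
   it says that they vanish as soon as alpha_n > 0.

   That the e_alpha form an orthonormal basis is derived from the expansion
   K(z, w) = sum_alpha e_alpha(z) conj(e_alpha(w)) alone.  The expansion and the
   Riesz representation theorem show that e_alpha is in H with norm at most 1,
   and that z_j is a multiplier.  Averaging kernels over points z for which
   phi(z) runs through roots of unity isolates one coefficient up to a small
   error, which gives orthonormality; the same averages give the uniqueness of
   the coefficients A_(P,m)(alpha). *)

Require Import Defs.
From HB Require Import structures.
From mathcomp Require Import all_boot all_order all_algebra finmap complex.
From mathcomp Require Import all_classical all_reals all_analysis summability.
From mathcomp.multinomials Require Import -(notations) mpoly.
From mathcomp Require Import cyclic separable cyclotomic ring.

Set Implicit Arguments.
Unset Strict Implicit.
Unset Printing Implicit Defensive.

Import Order.TTheory GRing.Theory Num.Theory numFieldNormedType.Exports.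

Local Open Scope classical_set_scope.
Local Open Scope ring_scope.

(** The space is given only through its kernel, so no norm formula decides which functions belong to
    it. Membership is obtained by duality: values prescribed on the triangle come from an element as
    soon as the functional that they induce on finite combinations of kernels is bounded. In general
    an expansion sum_alpha e_alpha(z) conj(e_alpha(w)) of a kernel makes the e_alpha only a Parseval
    frame, which may be linearly dependent. Orthonormality needs kernel combinations whose
    coefficient sequence is arbitrarily close to a unit vector. Integration over a torus would
    isolate a coefficient exactly; a finite average identifies exponents modulo N, and the error, a
    sum over exponents congruent to the chosen one but distinct from it, is small for large N
    because the series converges. On the operator side, positive regularity enters through the
    single inequality A(alpha + eps_j) >= a_j A(alpha), due to nonnegative coefficients, a_j > 0 and
    m_j > 0. It yields both the positivity of A and the boundedness of the weights of the shifts. *)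

Lemma invS_small (R : realType) (e : R[i]%C) : 0 < e ->
  exists N : nat, forall k, (N <= k)%N -> k.+1%:R^-1 < e.
Proof.
move=> e0; have /complex_realP[r er] := gtr0_real e0.
move: e0; rewrite {e}er ltcR => r0.
have [N] := ltr_add_invr r0; rewrite add0r => hN; exists N => k Nk.
rewrite -(rmorph_nat (real_complex R)) -fmorphV ltcR; apply: le_lt_trans hN.
by rewrite lef_pV2 ?posrE ?ltr0n // ler_nat.
Qed.

Lemma eq0_small (F : numFieldType) (V : normedZmodType F) (a : V) (K : F) :
  0 <= K -> (forall e, 0 < e -> `|a| <= K * e) -> a = 0.
Proof.
move=> K0 Ha; apply/eqP; apply: contraT; rewrite -normr_gt0 => a0.
have K1 : 0 < K + 1 by rewrite ltr_wpDl.
have := Ha (`|a| / (K + 1)); rewrite divr_gt0 // => /(_ isT).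
rewrite mulrCA -[leLHS]mulr1 ler_pM2l // ler_pdivlMr // mul1r.
by rewrite -subr_ge0 opprD addNKr oppr_ge0 ler10.
Qed.

Section Conj.
Context {F : numClosedFieldType}.
Implicit Types x y : F.

Lemma conjD x y : (x + y)^* = x^* + y^*. Proof. exact: rmorphD. Qed.
Lemma conjB x y : (x - y)^* = x^* - y^*. Proof. exact: rmorphB. Qed.
Lemma conjN x : (- x)^* = - x^*. Proof. exact: rmorphN. Qed.
Lemma conjM x y : (x * y)^* = x^* * y^*. Proof. exact: rmorphM. Qed.
Lemma conjV x : (x^-1)^* = (x^*)^-1. Proof. exact: fmorphV. Qed.
Lemma conjX x k : (x ^+ k)^* = x^* ^+ k. Proof. exact: rmorphXn. Qed.
Lemma conj_prod (I : Type) (s : seq I) (P : pred I) (E : I -> F) :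
  (\prod_(i <- s | P i) E i)^* = \prod_(i <- s | P i) (E i)^*.
Proof. exact: rmorph_prod. Qed.
Lemma conj_sum (I : Type) (s : seq I) (P : pred I) (E : I -> F) :
  (\sum_(i <- s | P i) E i)^* = \sum_(i <- s | P i) (E i)^*.
Proof. exact: rmorph_sum. Qed.

Definition conjE := (conjD, conjB, conjN, conjM, conjV, conjX, @conjCK F).

End Conj.

(** * Riesz representation *)

Section Hilbert.
Context {R : realType} {H : completeNormedModType R[i]%C}
  (ip : {dot H for Num.conj}).
Local Notation C := (R[i]%C).
Hypothesis ip_hilbert : hilbert ip.
Implicit Types (f g h u v : H) (a b : C).

Lemma ipDl f g h : ip (f + g) h = ip f h + ip g h.
Proof. by rewrite linearDl. Qed.

Lemma ipZl a f h : ip (a *: f) h = a * ip f h.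
Proof. by rewrite linearZl_LR. Qed.

Lemma ipBl f g h : ip (f - g) h = ip f h - ip g h.
Proof. by rewrite linearBl. Qed.

Lemma ipDr f g h : ip h (f + g) = ip h f + ip h g.
Proof. by rewrite linearDr. Qed.

Lemma ipBr f g h : ip h (f - g) = ip h f - ip h g.
Proof. by rewrite linearBr. Qed.

Lemma ipZr a f h : ip h (a *: f) = a^* * ip h f.
Proof. by rewrite linearZr_LR. Qed.

Lemma ip0l h : ip 0 h = 0.
Proof. by rewrite linear0l. Qed.

Lemma ip0r h : ip h 0 = 0.
Proof. by rewrite linear0r. Qed.

Lemma ip_suml (I : Type) (s : seq I) (F : I -> H) h :
  ip (\sum_(i <- s) F i) h = \sum_(i <- s) ip (F i) h.
Proof. by apply: (big_morph (ip^~ h)) => [f g|]; rewrite (ipDl, ip0l). Qed.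

Lemma ip_sumr (I : Type) (s : seq I) (F : I -> H) h :
  ip h (\sum_(i <- s) F i) = \sum_(i <- s) ip h (F i).
Proof. by apply: (big_morph (ip h)) => [f g|]; rewrite (ipDr, ip0r). Qed.

Lemma ipC f g : ip f g = (ip g f)^*.
Proof. by rewrite hermC expr0 mul1r. Qed.

Lemma sqnormD f g : `|f + g| ^+ 2 = `|f| ^+ 2 + `|g| ^+ 2 + (ip f g + (ip f g)^*).
Proof. by rewrite -!ip_hilbert !(ipDl, ipDr) (ipC g f); ring. Qed.

Lemma sqnormB f g : `|f - g| ^+ 2 = `|f| ^+ 2 + `|g| ^+ 2 - (ip f g + (ip f g)^*).
Proof. by rewrite -!ip_hilbert !(ipBl, ipBr) (ipC g f); ring. Qed.

Lemma cauchy_schwarz f g : `|ip f g| <= `|f| * `|g|.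
Proof.
have [->|g0] := eqVneq g 0; first by rewrite ip0r !normr0 mulr0.
have ng : 0 < `|g| by rewrite normr_gt0.
rewrite -(ler_pXn2r (ltn0Sn 1)) ?nnegrE ?mulr_ge0 //.
rewrite -(ler_pM2l (exprn_gt0 2 ng)) -subr_ge0.
have <- : `| `|g| ^+ 2 *: f - ip f g *: g| ^+ 2 =
   `|g| ^+ 2 * (`|f| * `|g|) ^+ 2 - `|g| ^+ 2 * `|ip f g| ^+ 2; last first.
  by rewrite exprn_ge0.
rewrite sqnormB !normrZ ipZl ipZr !exprMn !normr_id (normCK (ip f g)).
rewrite [(_ * (_ * _))^* ]rmorphM rmorphM /= !conjCK (geC0_conj (exprn_ge0 2 (normr_ge0 g))).
by ring.
Qed.

(* The representing vector minimises [`|u| ^+ 2 - 2 * Re x] over the graph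
   [S]; minimising sequences are Cauchy by the parallelogram law. *)
Lemma riesz_graph (S : H -> C -> Prop) (B : C) :
  S 0 0 ->
  (forall a u x v y, S u x -> S v y -> S (a *: u + v) (a * x + y)) ->
  0 <= B -> (forall u x, S u x -> `|x| <= B * `|u|) ->
  exists h, [/\ forall u x, S u x -> ip u h = x, `|h| <= B &
                closure [set u | exists x, S u x] h].
Proof.
move=> S0 Slin B0 Sbound.
pose q (u : H) (x : C) : C := `|u| ^+ 2 - (x + x^*).
have conjq u x : (q u x)^* = q u x.
  rewrite /q rmorphB rmorphD /= conjCK addrC [_ + x]addrC addrC.
  by rewrite geC0_conj ?exprn_ge0.
have qreal u x : q u x \is Num.real by rewrite CrealE conjq.
(* Twice the real part of [x] is at most 2 B |u|, and |u|^2 - 2 B |u| + B^2 is a square. *)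
have qlb u x : S u x -> - B ^+ 2 <= q u x.
  move=> Sux; rewrite /q.
  have h1 : x + x^* <= 2 * (B * `|u|).
    have rx : x + x^* \is Num.real.
      by rewrite CrealE rmorphD /= conjCK addrC.
    apply: le_trans (real_ler_norm rx) _.
    apply: le_trans (ler_normD _ _) _.
    by rewrite norm_conjC mulrDl mul1r lerD ?Sbound.
  rewrite -subr_ge0.
  apply: le_trans (_ : 0 <= (B - `|u|) ^+ 2) _.
    have : B - `|u| \is Num.real by rewrite realB ?ger0_real.
    by move=> ru; rewrite -real_normK // exprn_ge0.
  rewrite opprK (_ : (B - `|u|) ^+ 2 = `|u| ^+ 2 - 2 * (B * `|u|) + B ^+ 2); last by ring.
  by rewrite lerD2r lerD2l lerN2.
pose E : set R := [set r | exists u x, S u x /\ r%:C%C = q u x].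
have qE u x : S u x -> E (complex.Re (q u x)).
  move=> Sux; exists u, x; split=> //.
  exact: RRe_real.
have E0 : E !=set0 by exists (complex.Re (q 0 0)); exact: qE.
have Elb : has_inf E.
  split => //; exists (complex.Re (- B ^+ 2)) => r [u [x [Sux rq]]].
  move: (qlb u x Sux); rewrite -rq.
  by case: (- B ^+ 2) => a b; rewrite lecE /= => /andP[].
pose d : C := (inf E)%:C%C.
have dlb u x : S u x -> d <= q u x.
  by move=> Sux; rewrite -(RRe_real (qreal u x)) lecR; apply: ge_inf (qE _ _ _); case: Elb.
have /choice[s hs] k : exists p : H * C, S p.1 p.2 /\ q p.1 p.2 < d + k.+1%:R^-1.
  have k0 : 0 < k.+1%:R^-1 :> R by rewrite invr_gt0 ltr0n.
  have [r [u [x [Sux rq]]] rlt] := inf_adherent k0 Elb.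
  exists (u, x); split=> //=; rewrite -rq /d.
  by rewrite -(rmorph_nat (real_complex R)) -fmorphV -rmorphD ltcR.
have Sd k l : `|(s k).1 - (s l).1| ^+ 2 <= 2 * (k.+1%:R^-1 + l.+1%:R^-1).
  have [Sk qk] := hs k; have [Sl ql] := hs l.
  move: (s k).1 (s k).2 (s l).1 (s l).2 Sk qk Sl ql => u x v y Su qu Sv qv.
  have Sm := Slin 2^-1 _ _ _ _ (Slin 1 _ _ _ _ Su Sv) S0.
  rewrite !addr0 scale1r mul1r in Sm.
  have -> : `|u - v| ^+ 2 =
      2 * q u x + 2 * q v y - 4 * q (2^-1 *: (u + v)) (2^-1 * (x + y)).
    rewrite /q sqnormB normrZ exprMn normfV normr_nat sqnormD !rmorphM /=.
    by rewrite (@geC0_conj _ 2^-1) ?invr_ge0 // rmorphD; field.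
  have := dlb _ _ Sm; set qm := q _ (2^-1 * _) => dqm.
  apply: (@le_trans _ _ (2 * (d + k.+1%:R^-1) + 2 * (d + l.+1%:R^-1) - 4 * d)).
    apply: lerB; last by rewrite ler_pM2l.
    by apply: lerD; rewrite ler_pM2l // ltW.
  by rewrite le_eqVlt; apply/orP; left; apply/eqP; ring.
have [h hcv] : exists h : H, (fun k => (s k).1) @ \oo --> h.
  suff : cauchy ((fun k => (s k).1) @ \oo).
    by move=> /cauchy_cvg; exists (lim ((fun k => (s k).1) @ \oo)).
  apply: cauchy_exP => e e0.
  have e0' : 0 < e ^+ 2 / 4 by rewrite divr_gt0 ?exprn_gt0.
  have [N hN] := invS_small e0'.
  exists (s N).1; exists N => // k /= Nk; rewrite -ball_normE /=.
  rewrite -(ltr_pXn2r (ltn0Sn 1)) ?nnegrE ?(ltW e0) //.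
  apply: le_lt_trans (Sd _ _) _.
  rewrite (_ : e ^+ 2 = 2 * (e ^+ 2 / 4 + e ^+ 2 / 4)); last by field.
  by rewrite ltr_pM2l // ltrD // hN.
have hap (e e' : C) : 0 < e -> 0 < e' ->
    exists k, `|(s k).1 - h| < e /\ k.+1%:R^-1 < e'.
  move=> e0 e0'; have [N hN] := invS_small e0'.
  move/cvgrPdist_lt : hcv => /(_ e e0) [N' _ hN'].
  exists (maxn N N'); rewrite distrC hN' /= ?leq_maxr //; split=> //.
  by rewrite hN // leq_maxl.
have ipSh u x : S u x -> ip u h = x.
  move=> Sux; apply/eqP; rewrite -subr_eq0; apply/eqP.
  (* Moving the near-minimiser by a suitable multiple of [u] lowers [q] by at least |dl|^2 / M,
     which near-minimality bounds by 1 / (k + 1). Taking |u|^2 + 1 instead of |u|^2 for [M] avoids a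
     separate case [u = 0]. *)
  have [M EM] : exists M : C, M = `|u| ^+ 2 + 1 by exists (`|u| ^+ 2 + 1).
  have M0 : 0 < M by rewrite EM ltr_wpDl ?exprn_ge0.
  have near_k k : `|ip u (s k).1 - x| ^+ 2 / M <= k.+1%:R^-1.
    have [Sk qk] := hs k.
    have [dl Edl] : exists dl, dl = ip u (s k).1 - x by exists (ip u (s k).1 - x).
    rewrite -Edl.
    have M1 : M \is Num.real by exact: gtr0_real.
    have := dlb _ _ (Slin (- (dl^* / M)) _ _ _ _ Sux Sk).
    have -> : q (- (dl^* / M) *: u + (s k).1) (- (dl^* / M) * x + (s k).2) =
        q (s k).1 (s k).2 - (`|dl| ^+ 2 / M + `|dl| ^+ 2 / M ^+ 2).
      rewrite /q sqnormD normrZ exprMn normrN normf_div norm_conjC (gtr0_norm M0).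
      rewrite ipZl !conjE (CrealP M1).
      rewrite expr_div_n (_ : `|u| ^+ 2 = M - 1); last by rewrite EM addrK.
      rewrite (_ : ip u (s k).1 = dl + x); last by rewrite Edl subrK.
      by rewrite conjD normCK; field; rewrite lt0r_neq0.
    rewrite lerBrDr -lerBrDl => dq.
    apply: le_trans (_ : `|dl| ^+ 2 / M + `|dl| ^+ 2 / M ^+ 2 <= _).
      by rewrite lerDl divr_ge0 ?exprn_ge0 ?(ltW M0).
    by apply: (le_trans dq); rewrite lerBlDl ltW.
  apply: (@eq0_small _ _ _ (`|u| + 1)) => [|e e0]; first by rewrite addr_ge0.
  have [|k [k1 k2]] := hap e (e ^+ 2 / M) e0; first by rewrite divr_gt0 ?exprn_gt0.
  rewrite (_ : ip u h - x = - ip u ((s k).1 - h) + (ip u (s k).1 - x)); last first.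
    by rewrite ipBr; ring.
  apply: le_trans (ler_normD _ _) _; rewrite normrN mulrDl mul1r lerD //.
    by apply: le_trans (cauchy_schwarz _ _) _; rewrite ler_wpM2l // ltW.
  rewrite -(ler_pXn2r (ltn0Sn 1)) ?nnegrE ?(ltW e0) //.
  by have := le_trans (near_k k) (ltW k2); rewrite ler_pM2r ?invr_gt0.
exists h; split=> //.
- have [->|h0] := eqVneq h 0; first by rewrite normr0.
  have nh : 0 < `|h| by rewrite normr_gt0.
  have rB : B \is Num.real by exact: ger0_real.
  have [//|Bh] := real_leP (normr_real h) rB.
  (* [h] is only a limit of the domain of [S], so the bound is applied to [(s k).1], at the price of
     an error linear in [e]. *)
  suff /eqP : `|h| * (`|h| - B) = 0 by rewrite mulf_eq0 gt_eqF //= subr_eq0 gt_eqF.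
  apply: (@eq0_small _ _ _ (`|h| + B)) => [|e e0]; first by rewrite addr_ge0.
  have [k [k1 _]] := hap e e e0 e0.
  rewrite ger0_norm ?mulr_ge0 ?subr_ge0 ?(ltW Bh) // mulrBr -expr2 lerBlDr.
  have -> : `|h| ^+ 2 = `|ip h h| by rewrite ip_hilbert ger0_norm ?exprn_ge0.
  rewrite (_ : ip h h = ip (s k).1 h - ip ((s k).1 - h) h); last first.
    by rewrite ipBl; ring.
  apply: le_trans (ler_normB _ _) _.
  have [Sk _] := hs k.
  have l1 : `|ip (s k).1 h| <= B * (e + `|h|).
    rewrite (ipSh _ _ Sk); apply: le_trans (Sbound _ _ Sk) _.
    rewrite ler_wpM2l // -{1}(subrK h (s k).1).
    by apply: le_trans (ler_normD _ _) _; rewrite lerD2r ltW.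
  have l2 : `|ip ((s k).1 - h) h| <= e * `|h|.
    by apply: le_trans (cauchy_schwarz _ _) _; rewrite ler_wpM2r // ltW.
  by apply: le_trans (lerD l1 l2) _; rewrite le_eqVlt; apply/orP; left; apply/eqP; ring.
- move=> U /nbhs_ballP[e /= e0 eU].
  have [k [k1 _]] := hap e e e0 e0.
  exists (s k).1; split; first by exists (s k).2; case: (hs k).
  by apply: eU; rewrite -ball_normE /= distrC.
Qed.
End Hilbert.
(** * Unconditional sums *)

#[local] Existing Instance totally_filter.

Section Sums.
Context {R : realType} {I : choiceType}.
Local Notation C := (R[i]%C).
Implicit Types (b : I -> C) (l : C).

Definition has_sum b l := forall e : C, 0 < e ->
  exists F0 : {fset I}, forall F : {fset I}, (F0 `<=` F)%fset ->
  `|\sum_(i <- F) b i - l| < e.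

Lemma has_sumP b l :
  has_sum b l <-> partial_sum (b : I -> C^o) @ totally --> (l : C^o).
Proof.
split=> [bl|/cvgrPdist_lt bl e e0].
  apply/cvgrPdist_lt => e e0; have [F0 hF0] := bl e e0.
  by exists F0 => // F /hF0; rewrite distrC /partial_sum big_seq_fsetE.
have [F0 _ hF0] := bl e e0.
by exists F0 => F /hF0; rewrite /partial_sum big_seq_fsetE distrC.
Qed.

Lemma has_sum_unique b l l' : has_sum b l -> has_sum b l' -> l = l'.
Proof.
move=> bl bl'; apply/eqP; rewrite -subr_eq0; apply/eqP.
apply: (@eq0_small _ _ _ 2) => // e e0.
have [F hF] := bl e e0; have [F' hF'] := bl' e e0.
have := hF (F `|` F')%fset (fsubsetUl _ _); have := hF' (F `|` F')%fset (fsubsetUr _ _).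
set s := \sum_(i <- _) _ => s1 s2.
rewrite (_ : l - l' = (s - l') - (s - l)); last by ring.
by apply: le_trans (ler_normB _ _) _; rewrite mulrDl mul1r lerD // ltW.
Qed.

Lemma eq_has_sum b b' l : b =1 b' -> has_sum b l -> has_sum b' l.
Proof. by move=> /funext->. Qed.

Lemma has_sum0 : has_sum (fun=> 0) 0.
Proof. by move=> e e0; exists fset0%fset => F _; rewrite big1 // subrr normr0. Qed.

Lemma has_sumZ b l (a : C) : has_sum b l -> has_sum (fun i => a * b i) (a * l).
Proof.
move=> bl e e0; have [->|a0] := eqVneq a 0.
  by exists fset0%fset => F _; rewrite -mulr_sumr !mul0r subrr normr0.
have [|F hF] := bl (e / `|a|); first by rewrite divr_gt0 ?normr_gt0.
exists F => F' FF'; rewrite -mulr_sumr -mulrBr normrM mulrC.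
by rewrite -ltr_pdivlMr ?normr_gt0 // hF.
Qed.

Lemma has_sumD b b' l l' : has_sum b l -> has_sum b' l' ->
  has_sum (fun i => b i + b' i) (l + l').
Proof.
move=> bl bl' e e0; have e2 : 0 < e / 2 by rewrite divr_gt0.
have [F hF] := bl _ e2; have [F' hF'] := bl' _ e2.
exists (F `|` F')%fset => G; rewrite fsubUset => /andP[/hF G1 /hF' G2].
rewrite big_split /= opprD addrACA; apply: le_lt_trans (ler_normD _ _) _.
by rewrite [ltRHS]splitr ltrD.
Qed.

Lemma has_sum_sum (J : Type) (s : seq J) (b : J -> I -> C) (l : J -> C) :
  (forall j, has_sum (b j) (l j)) ->
  has_sum (fun i => \sum_(j <- s) b j i) (\sum_(j <- s) l j).
Proof.
move=> bl; elim: s => [|j s IHs].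
  by rewrite big_nil; apply: eq_has_sum has_sum0 => i; rewrite big_nil.
rewrite big_cons; apply: eq_has_sum (has_sumD (bl j) IHs) => i.
by rewrite big_cons.
Qed.

Lemma ler_sum_fset b (F G : {fset I}) : (forall i, 0 <= b i) ->
  (F `<=` G)%fset -> \sum_(i <- F) b i <= \sum_(i <- G) b i.
Proof.
move=> b0 /fsubsetP FG; rewrite [leRHS](big_fsetID _ (mem F)) /=.
rewrite (_ : [fset x in G | x \in F]%fset = F); last first.
  by apply/fsetP => x; rewrite !inE /=; case: (boolP (x \in F)) => [/FG ->|]; rewrite ?andbF.
by rewrite lerDl sumr_ge0.
Qed.

Lemma has_sum_ge b l (F : {fset I}) : (forall i, 0 <= b i) ->
  l \is Num.real -> has_sum b l -> \sum_(i <- F) b i <= l.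
Proof.
move=> b0 lr bl; have sr G : \sum_(i <- G) b i \is Num.real.
  by rewrite realE sumr_ge0.
have [//|lF] := real_leP (sr F) lr.
have [|F0 hF0] := bl (\sum_(i <- F) b i - l); first by rewrite subr_gt0.
have := hF0 (F0 `|` F)%fset (fsubsetUl _ _) => /lt_geF <-.
apply: le_trans (real_ler_norm _); rewrite ?realB // lerD2r.
exact: ler_sum_fset b0 (fsubsetUr _ _).
Qed.

Lemma has_sum_le b l M : l \is Num.real -> M \is Num.real ->
  has_sum b l -> (forall F : {fset I}, \sum_(i <- F) b i <= M) -> l <= M.
Proof.
move=> lr Mr bl bM; have [//|Ml] := real_leP lr Mr.
have [|F hF] := bl (l - M); first by rewrite subr_gt0.
have := hF F (fsubset_refl _) => /lt_geF <-.
rewrite distrC; apply: le_trans (real_ler_norm _); last first.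
  (* The order is partial: the partial sum is real because it differs from the real [M] by a
     nonpositive number. *)
  by rewrite realB // -(subrK M (\sum_(i <- F) _)) realD // ler0_real // subr_le0.
by rewrite lerD2l lerN2.
Qed.

Lemma has_sum_tail b l (e : C) : has_sum b l -> 0 < e ->
  exists F0 : {fset I}, forall F : {fset I}, [disjoint F0 & F]%fset ->
  `|\sum_(i <- F) b i| < e.
Proof.
move=> bl e0; have e2 : 0 < e / 2 by rewrite divr_gt0.
have [F0 hF0] := bl _ e2; exists F0 => F F0F.
have := hF0 (F0 `|` F)%fset (fsubsetUl _ _); have := hF0 F0 (fsubset_refl _).
rewrite (@big_fsetID _ _ _ _ (mem F0) (F0 `|` F)%fset) /=.
rewrite (_ : [fset x in (F0 `|` F)%fset | x \in F0]%fset = F0); last first.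
  by apply/fsetP => x; rewrite !inE /=; case: (x \in F0); rewrite ?andbF.
rewrite (_ : [fset x in (F0 `|` F)%fset | x \notin F0]%fset = F); last first.
  apply/fsetP => x; rewrite !inE /=; have := fdisjointP F0F x.
  by case: (x \in F0) => /= [/(_ isT)/negPf->|_]; rewrite ?andbT.
set s := \sum_(i <- F0) _; set s' := \sum_(i <- F) _ => s1 s2.
rewrite (_ : s' = (s + s' - l) - (s - l)); last by ring.
by apply: le_lt_trans (ler_normB _ _) _; rewrite [ltRHS]splitr ltrD.
Qed.

End Sums.
(** * Power series of a product of geometric series *)

Section Geometric.
Context {R : realType}.
Local Notation C := (R[i]%C).

Lemma expr_small (t e : C) : `|t| < 1 -> 0 < e ->
  exists N0, forall N, (N0 <= N)%N -> `|t ^+ N| < e.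
Proof.
have /complex_realP[r Er] := normr_real t.
move=> t1 e0; have /complex_realP[s Es] := gtr0_real e0.
move: e0 t1; rewrite Es Er !ltcR => s0 r1.
have r0 : 0 <= r by rewrite -ler0c -Er.
have := @cvg_expr R r; rewrite ger0_norm // => /(_ r1) /cvgrPdist_lt/(_ s s0)[N0 _ h].
exists N0 => N /h /=; rewrite sub0r normrN ger0_norm ?exprn_ge0 // => rs.
by rewrite normrX Er -rmorphXn ltcR.
Qed.

Lemma geometric_sum (t : C) (N : nat) :
  (\sum_(k < N) t ^+ k) * (1 - t) = 1 - t ^+ N.
Proof. by rewrite mulrC -(opprB t 1) mulNr -subrX1 opprB. Qed.

Definition seq_cvg (u : nat -> C) (l : C) := forall e : C, 0 < e ->
  exists N0, forall N, (N0 <= N)%N -> `|u N - l| < e.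

Lemma seq_cvg_cst (l : C) : seq_cvg (fun=> l) l.
Proof. by move=> e e0; exists 0%N => N _; rewrite subrr normr0. Qed.

Lemma seq_cvgM (u v : nat -> C) (l k : C) :
  seq_cvg u l -> seq_cvg v k -> seq_cvg (fun N => u N * v N) (l * k).
Proof.
move=> ul vk e e0; pose M := 1 + `|l| + `|k|.
have M0 : 0 < M by rewrite /M -addrA ltr_wpDr ?addr_ge0.
have eM : 0 < e + M := addr_gt0 e0 M0.
(* This tolerance is at most 1, which absorbs the product of the two errors, and its product with
   [M] is below [e]. *)
have d0 : 0 < e / (e + M) := divr_gt0 e0 eM.
have [N1 h1] := ul _ d0; have [N2 h2] := vk _ d0.
exists (maxn N1 N2) => N; rewrite geq_max => /andP[/h1 {}h1 /h2 {}h2].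
set d := e / (e + M) in d0 h1 h2.
have d1 : d <= 1 by rewrite /d (ler_pdivrMr _ _ eM) mul1r lerDl ltW.
have dM : d * M < e.
  by rewrite /d mulrAC (ltr_pdivrMr _ _ eM) (ltr_pM2l e0) ltrDr.
rewrite (_ : _ - _ = (u N - l) * (v N - k) + l * (v N - k) + (u N - l) * k); last by ring.
apply: le_lt_trans dM; rewrite (_ : d * M = d + d * `|l| + d * `|k|); last by rewrite /M; ring.
apply: le_trans (ler_normD _ _) _; apply: lerD; last first.
  by rewrite normrM ler_wpM2r // ltW.
apply: le_trans (ler_normD _ _) _; apply: lerD; last first.
  by rewrite normrM [leRHS]mulrC ler_wpM2l // ltW.
rewrite normrM -[leRHS]mulr1; apply: ler_pM => //; first exact: ltW.
by apply: le_trans d1; exact: ltW.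
Qed.

Lemma seq_cvgX (u : nat -> C) (l : C) k :
  seq_cvg u l -> seq_cvg (fun N => u N ^+ k) (l ^+ k).
Proof.
move=> ul; elim: k => [|k IHk]; first exact: seq_cvg_cst.
rewrite exprS (_ : (fun N => _) = fun N => u N * u N ^+ k); first exact: seq_cvgM.
by apply/funext => N; rewrite exprS.
Qed.

Lemma seq_cvg_prod (I : Type) (s : seq I) (u : I -> nat -> C) (l : I -> C) :
  (forall i, seq_cvg (u i) (l i)) ->
  seq_cvg (fun N => \prod_(i <- s) u i N) (\prod_(i <- s) l i).
Proof.
move=> ul; elim: s => [|i s IHs].
  rewrite big_nil (_ : (fun N => _) = fun=> 1); first exact: seq_cvg_cst.
  by apply/funext => N; rewrite big_nil.
rewrite big_cons (_ : (fun N => _) = fun N => u i N * \prod_(i <- s) u i N).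
  exact: seq_cvgM.
by apply/funext => N; rewrite big_cons.
Qed.

Lemma seq_cvg_geometric (t : C) : `|t| < 1 ->
  seq_cvg (fun N => \sum_(k < N.+1) t ^+ k) (1 - t)^-1.
Proof.
move=> t1 e e0; have t0 : 1 - t != 0.
  by rewrite subr_eq0; apply/eqP => e1; move: t1; rewrite -e1 normr1 ltxx.
have [|N0 hN0] := @expr_small t (e * `|1 - t|) t1.
  by rewrite mulr_gt0 ?normr_gt0.
exists N0 => N NN.
have -> : \sum_(k < N.+1) t ^+ k - (1 - t)^-1 = - (t ^+ N.+1 / (1 - t)).
  apply: (mulIf t0); rewrite mulrBl mulVf // mulNr divfK // geometric_sum; ring.
by rewrite normrN normrM normfV ltr_pdivrMr ?normr_gt0 // hN0 // leqW.
Qed.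

Lemma geometric_le (t : C) (N : nat) : 0 <= t -> t < 1 ->
  \sum_(k < N.+1) t ^+ k <= (1 - t)^-1.
Proof.
move=> t0 t1; have t2 : 0 < 1 - t by rewrite subr_gt0.
rewrite -(ler_pM2r t2) mulVf ?lt0r_neq0 //.
by rewrite geometric_sum lerBlDr lerDl exprn_ge0.
Qed.
End Geometric.

(** * Coefficientwise comparison of polynomials *)

Section MPolyOrder.
Context {F : numDomainType} {n : nat}.
Implicit Types (p q : mpoly n F) (alpha beta : multinom n).

Definition mpoly_nneg p := forall alpha, 0 <= mcoeff alpha p.
Definition mpoly_le p q := forall alpha, mcoeff alpha p <= mcoeff alpha q.
Definition mpoly_eqmod (d : nat) p q :=
  forall alpha, (mdeg alpha <= d)%N -> mcoeff alpha p = mcoeff alpha q.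

Lemma mpoly_nneg1 : mpoly_nneg 1.
Proof. by move=> alpha; rewrite mcoeff1 ler0n. Qed.

Lemma mpoly_nnegM p q : mpoly_nneg p -> mpoly_nneg q -> mpoly_nneg (p * q).
Proof.
by move=> p0 q0 alpha; rewrite mcoeffM sumr_ge0 // => k _; rewrite mulr_ge0.
Qed.

Lemma mpoly_nnegX p k : mpoly_nneg p -> mpoly_nneg (p ^+ k).
Proof.
move=> p0; elim: k => [|k IHk]; first by rewrite expr0; exact: mpoly_nneg1.
by rewrite exprS; apply: mpoly_nnegM.
Qed.

Lemma mpoly_nneg_sum (I : Type) (s : seq I) (p_ : I -> mpoly n F) :
  (forall i, mpoly_nneg (p_ i)) -> mpoly_nneg (\sum_(i <- s) p_ i).
Proof. by move=> p0 alpha; rewrite raddf_sum sumr_ge0 // => i _; exact: p0. Qed.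

Lemma mpoly_nneg_prod (I : Type) (s : seq I) (Q : pred I) (p_ : I -> mpoly n F) :
  (forall i, mpoly_nneg (p_ i)) -> mpoly_nneg (\prod_(i <- s | Q i) p_ i).
Proof.
by move=> p0; elim/big_ind: _ => [|p q|i _]; [exact: mpoly_nneg1|exact: mpoly_nnegM|].
Qed.

Lemma mpoly_leM p p' q q' : mpoly_nneg p -> mpoly_nneg q ->
  mpoly_le p p' -> mpoly_le q q' -> mpoly_le (p * q) (p' * q').
Proof.
by move=> p0 q0 pp' qq' alpha; rewrite !mcoeffM ler_sum // => k _; rewrite ler_pM.
Qed.

Lemma mpoly_leX p q k : mpoly_nneg p -> mpoly_le p q -> mpoly_le (p ^+ k) (q ^+ k).
Proof.
move=> p0 pq; elim: k => [|k IHk]; first by rewrite !expr0 => alpha.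
by rewrite !exprS; exact: (mpoly_leM p0 (mpoly_nnegX k p0) pq IHk).
Qed.

Lemma mpoly_le_prod (I : Type) (s : seq I) (Q : pred I) (p_ q_ : I -> mpoly n F) :
  (forall i, mpoly_nneg (p_ i)) -> (forall i, mpoly_le (p_ i) (q_ i)) ->
  mpoly_le (\prod_(i <- s | Q i) p_ i) (\prod_(i <- s | Q i) q_ i).
Proof.
move=> p0 pq; elim: s => [|i s IHs]; first by rewrite !big_nil.
rewrite !big_cons; case: ifP => // _; apply: mpoly_leM => //.
exact: mpoly_nneg_prod.
Qed.

Lemma mpoly_eqmodM d p p' q q' : mpoly_eqmod d p p' -> mpoly_eqmod d q q' ->
  mpoly_eqmod d (p * q) (p' * q').
Proof.
move=> pp' qq' alpha da; rewrite !mcoeffM; apply: eq_bigr => k _.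
by rewrite pp' ?qq' // (leq_trans _ da) // -ltnS bmdeg.
Qed.

Lemma mpoly_eqmodX d p q k : mpoly_eqmod d p q -> mpoly_eqmod d (p ^+ k) (q ^+ k).
Proof.
move=> pq; elim: k => [|k IHk]; first by rewrite !expr0.
by rewrite !exprS; exact: (mpoly_eqmodM pq IHk).
Qed.

Lemma mpoly_eqmod_prod d (I : Type) (s : seq I) (p_ q_ : I -> mpoly n F) :
  (forall i, mpoly_eqmod d (p_ i) (q_ i)) ->
  mpoly_eqmod d (\prod_(i <- s) p_ i) (\prod_(i <- s) q_ i).
Proof.
move=> pq; elim: s => [|i s IHs]; first by rewrite !big_nil.
by rewrite !big_cons; exact: mpoly_eqmodM.
Qed.

Lemma mcoeffX_eq0 p k alpha : mcoeff (@mnm0 n) p = 0 -> (mdeg alpha < k)%N ->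
  mcoeff alpha (p ^+ k) = 0.
Proof.
move=> p0; elim: k alpha => [//|k IHk] alpha ka.
rewrite exprS mcoeffM big1 // => -[/= [b1 /= b1a] [b2 /= b2a]] /= /eqP Ea; clear b1a b2a.
have [b0|b0] := eqVneq (mdeg b1) 0%N.
  by move/eqP: b0; rewrite mdeg_eq0 => /eqP->; rewrite p0 mul0r.
rewrite (IHk b2) ?mulr0 //; move: ka; rewrite Ea mdegD ltnS.
by apply: leq_trans; rewrite -add1n leq_add2r lt0n.
Qed.

End MPolyOrder.

(** * The power series of the product, by truncation *)

Section PowerSeries.
Context {R : realType} {n : nat}.
Local Notation C := (R[i]%C).
Local Notation V := 'rV[C]_n.
Variables (P : 'I_n -> mpoly n C) (m : 'I_n -> nat).
Hypothesis P_nneg : forall j, mpoly_nneg (P j).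
Hypothesis P_const : forall j, mcoeff (@mnm0 n) (P j) = 0.
Implicit Types (x : V) (alpha : multinom n) (p : mpoly n C).

Definition entrywise_norm x : V := \row_j `|x 0 j|.

Lemma norm_monomial x alpha : `|monomial x alpha| = monomial (entrywise_norm x) alpha.
Proof. by rewrite normr_prod; apply: eq_bigr => j _; rewrite normrX mxE. Qed.

Lemma monomialD x alpha beta :
  monomial x (mnm_add alpha beta) = monomial x alpha * monomial x beta.
Proof. by rewrite -big_split; apply: eq_bigr => j _; rewrite mnmDE exprD. Qed.

Lemma monomial0 x : monomial x (@mnm0 n) = 1.
Proof. by rewrite /monomial big1 // => j _; rewrite mnm0E expr0. Qed.

Lemma monomial1 x j : monomial x (mnm1 j) = x 0 j.
Proof.
rewrite /monomial (bigD1 j) //= mnm1E eqxx expr1 big1 ?mulr1 // => k kj.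
by rewrite mnm1E eq_sym (negPf kj) expr0.
Qed.

Lemma monomial_ge0 x alpha : (forall j, 0 <= x 0 j) -> 0 <= monomial x alpha.
Proof. by move=> x0; apply: prodr_ge0 => j _; rewrite exprn_ge0. Qed.

Lemma pevalE p x : peval p x = \sum_(alpha <- msupp p) mcoeff alpha p * monomial x alpha.
Proof. exact: mevalE. Qed.

Lemma pevalE_sub p x (F : {fset multinom n}) :
  {subset msupp p <= F} -> peval p x = \sum_(alpha <- F) mcoeff alpha p * monomial x alpha.
Proof.
move=> pF; rewrite pevalE [RHS](bigID (mem (msupp p))) /=.
rewrite [X in _ = _ + X]big1 => [|alpha]; last first.
  by move=> /memN_msupp_eq0 ->; rewrite mul0r.
rewrite [RHS]addr0 -[RHS]big_filter; apply: perm_big; apply: uniq_perm.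
- exact: msupp_uniq.
- by rewrite filter_uniq // fset_uniq.
by move=> alpha; rewrite mem_filter /=; case: (boolP (alpha \in msupp p)) => // /pF ->.
Qed.

Lemma norm_peval_le p x : mpoly_nneg p -> `|peval p x| <= peval p (entrywise_norm x).
Proof.
move=> p0; rewrite !pevalE; apply: le_trans (ler_norm_sum _ _ _) _.
by apply: ler_sum => alpha _; rewrite normrM ger0_norm // -norm_monomial.
Qed.

Lemma peval_ge0 p x : mpoly_nneg p -> (forall j, 0 <= x 0 j) -> 0 <= peval p x.
Proof.
move=> p0 x0; rewrite pevalE sumr_ge0 // => alpha _.
by rewrite mulr_ge0 // (monomial_ge0 alpha x0).
Qed.

Definition trunc_geom N p : mpoly n C := \sum_(k < N.+1) p ^+ k.
Definition trunc_series N : mpoly n C := \prod_j trunc_geom N (P j) ^+ m j.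
(** Polynomials suffice to define the power series: as [P j] has no constant term, [P j ^+ k] starts
    in degree k, so the coefficient at [alpha] is settled once the geometric series are cut at the
    degree of [alpha]. *)
Definition series_coef alpha : C := mcoeff alpha (trunc_series (mdeg alpha)).
Definition series_fun x : C := \prod_j ((1 - peval (P j) x) ^+ m j)^-1.

Lemma trunc_geom_nneg N p : mpoly_nneg p -> mpoly_nneg (trunc_geom N p).
Proof. by move=> p0; apply: mpoly_nneg_sum => k; exact: mpoly_nnegX. Qed.

Lemma trunc_series_nneg N : mpoly_nneg (trunc_series N).
Proof. by apply: mpoly_nneg_prod => j; exact/mpoly_nnegX/trunc_geom_nneg. Qed.

Lemma trunc_geomS N p : trunc_geom N.+1 p = trunc_geom N p + p ^+ N.+1.
Proof. by rewrite /trunc_geom big_ord_recr. Qed.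

Lemma trunc_geom_le N p : mpoly_nneg p -> mpoly_le (trunc_geom N p) (trunc_geom N.+1 p).
Proof.
move=> p0 alpha; rewrite trunc_geomS mcoeffD lerDl.
exact: (@mpoly_nnegX _ _ p N.+1 p0 alpha).
Qed.

Lemma trunc_series_le N N' : (N <= N')%N -> mpoly_le (trunc_series N) (trunc_series N').
Proof.
move=> NN'; rewrite -(subnK NN'); elim: (N' - N)%N => [|k IHk] alpha //.
apply: le_trans (IHk alpha) _; rewrite addSn.
apply: mpoly_le_prod => j; first exact/mpoly_nnegX/trunc_geom_nneg.
by apply: mpoly_leX; [exact: trunc_geom_nneg|exact: trunc_geom_le].
Qed.

Lemma trunc_series_stable N alpha : (mdeg alpha <= N)%N ->
  mcoeff alpha (trunc_series N) = series_coef alpha.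
Proof.
move=> aN; rewrite /series_coef -(subnK aN).
elim: (N - _)%N => [|k IHk]; first by rewrite add0n.
rewrite addSn -IHk.
have : mpoly_eqmod (k + mdeg alpha) (trunc_series (k + mdeg alpha).+1)
   (trunc_series (k + mdeg alpha)).
  apply: mpoly_eqmod_prod => j; apply: mpoly_eqmodX => beta kb.
  by rewrite trunc_geomS mcoeffD mcoeffX_eq0 ?addr0.
by apply; rewrite leq_addl.
Qed.

Lemma trunc_series_coef_le N alpha : mcoeff alpha (trunc_series N) <= series_coef alpha.
Proof.
rewrite -(@trunc_series_stable (maxn N (mdeg alpha))) ?leq_maxr //.
exact: trunc_series_le (leq_maxl _ _) alpha.
Qed.

Lemma series_coef_ge0 alpha : 0 <= series_coef alpha.
Proof. exact: trunc_series_nneg. Qed.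

Lemma peval_trunc_series N x :
  peval (trunc_series N) x = \prod_j (\sum_(k < N.+1) peval (P j) x ^+ k) ^+ m j.
Proof.
rewrite /peval rmorph_prod; apply: eq_bigr => j _; rewrite rmorphXn /=; congr (_ ^+ _).
by rewrite rmorph_sum; apply: eq_bigr => k _; rewrite rmorphXn.
Qed.

Lemma trunc_series_le_fun N x : (forall j, 0 <= x 0 j) -> (forall j, peval (P j) x < 1) ->
  peval (trunc_series N) x <= series_fun x.
Proof.
move=> x0 x1; rewrite peval_trunc_series; apply: ler_prod => j _.
have p0 : 0 <= peval (P j) x by exact: peval_ge0.
rewrite exprn_ge0 ?sumr_ge0 //=; last by move=> k _; rewrite exprn_ge0.
rewrite -exprVn; apply: lerXn2r; rewrite ?nnegrE ?geometric_le //.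
  by rewrite sumr_ge0 // => k _; rewrite exprn_ge0.
by rewrite invr_ge0 subr_ge0 ltW.
Qed.

Lemma seq_cvg_trunc_series x : (forall j, `|peval (P j) x| < 1) ->
  seq_cvg (fun N => peval (trunc_series N) x) (series_fun x).
Proof.
move=> x1; rewrite (_ : (fun N => _) = fun N => \prod_j
  (\sum_(k < N.+1) peval (P j) x ^+ k) ^+ m j); last first.
  by apply/funext => N; rewrite peval_trunc_series.
apply: (@seq_cvg_prod _ _ _ (fun j N => (\sum_(k < N.+1) peval (P j) x ^+ k) ^+ m j)) => j.
by rewrite -exprVn; exact/seq_cvgX/seq_cvg_geometric.
Qed.

(* Comparing with the majorant at the entrywise absolute value bounds the tail
   of the series at [x] by [series_fun |x| - trunc_series N |x|]. *)
Lemma has_sum_series x : (forall j, peval (P j) (entrywise_norm x) < 1) ->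
  has_sum (fun alpha => series_coef alpha * monomial x alpha) (series_fun x).
Proof.
move=> x1 e e0; set y := entrywise_norm x.
have y0 j : 0 <= y 0 j by rewrite mxE.
have py0 j : 0 <= peval (P j) y by exact: peval_ge0.
have px1 j : `|peval (P j) x| < 1 by apply: le_lt_trans (x1 j); exact: norm_peval_le.
have py1 j : `|peval (P j) y| < 1 by rewrite ger0_norm.
have e2 : 0 < e / 2 by rewrite divr_gt0.
have [N1 hN1] := seq_cvg_trunc_series px1 e2.
have [N2 hN2] := seq_cvg_trunc_series py1 e2.
pose N := maxn N1 N2.
have {}hN1 := hN1 N (leq_maxl _ _); have {}hN2 := hN2 N (leq_maxr _ _).
exists [fset alpha in msupp (trunc_series N)]%fset => F /fsubsetP FN.
have {}FN : {subset msupp (trunc_series N) <= F} by move=> alpha aN; apply: FN; rewrite inE.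
have bound (G : {fset multinom n}) :
    \sum_(alpha <- G) series_coef alpha * monomial y alpha <= series_fun y.
  (* [M] dominates the degree of every exponent in [G], so the truncation at [M] already has the
     final coefficients on [G]. *)
  pose M := (\sum_(alpha <- G) mdeg alpha)%N.
  apply: (@le_trans _ _ (peval (trunc_series M) y)); last exact: trunc_series_le_fun.
  rewrite (@pevalE_sub _ y (G `|` [fset alpha in msupp (trunc_series M)])%fset); last first.
    by move=> alpha aM; rewrite !inE aM orbT.
  apply: le_trans (ler_sum_fset _ (fsubsetUl G _)); last first.
    by move=> alpha; rewrite mulr_ge0 ?monomial_ge0 //; exact: trunc_series_nneg.
  rewrite le_eqVlt; apply/orP; left; apply/eqP.
  apply: eq_big_seq => alpha aG; rewrite trunc_series_stable //.
  by rewrite /M (big_fsetD1 alpha) //= leq_addr.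
rewrite (_ : _ - _ = (\sum_(alpha <- F) (series_coef alpha - mcoeff alpha (trunc_series N)) *
   monomial x alpha) + (peval (trunc_series N) x - series_fun x)); last first.
  rewrite (pevalE_sub x FN) addrA; congr (_ - _).
  by rewrite -big_split; apply: eq_bigr => alpha _ /=; ring.
apply: le_lt_trans (ler_normD _ _) _; rewrite [ltRHS]splitr.
apply: ltrD; last exact: hN1.
apply: le_lt_trans (ler_norm_sum _ _ _) _.
apply: le_lt_trans hN2; rewrite distrC ger0_norm ?subr_ge0 ?trunc_series_le_fun //.
apply: (le_trans _ (lerB (bound F) (lexx _))).
rewrite (pevalE_sub y FN) -sumrB; apply: ler_sum => alpha _.
rewrite normrM norm_monomial -mulrBl ger0_norm //.
by rewrite subr_ge0 trunc_series_coef_le.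
Qed.

Lemma series_coef0 : series_coef (@mnm0 n) = 1.
Proof.
rewrite /series_coef mdeg0 /trunc_series big1 => [|j _]; first by rewrite mcoeff1 eqxx.
by rewrite /trunc_geom big_ord1 expr0 expr1n.
Qed.

Hypothesis m_gt0 : forall j, (0 < m j)%N.

(* [1 / (1 - p) ^ k >= p / (1 - p) ^ k] coefficientwise, as [k > 0]. *)
Lemma series_coef_step alpha j :
  mcoeff (mnm1 j) (P j) * series_coef alpha <= series_coef (mnm_add alpha (mnm1 j)).
Proof.
pose a := mcoeff (mnm1 j) (P j); pose N := mdeg alpha.
have step k : (0 < k)%N -> mpoly_le (P j * trunc_geom N (P j) ^+ k) (trunc_geom N.+1 (P j) ^+ k).
  case: k => // k _; rewrite !exprS mulrA.
  apply: mpoly_leM.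
  - by apply: mpoly_nnegM => //; exact: trunc_geom_nneg.
  - exact/mpoly_nnegX/trunc_geom_nneg.
  - move=> beta; rewrite /trunc_geom [in leRHS]big_ord_recl mcoeffD mulr_sumr.
    rewrite [X in _ <= _ + mcoeff _ X](_ : _ = \sum_(i < N.+1) P j * P j ^+ i); last first.
      by apply: eq_bigr => i _; rewrite -exprS.
    by rewrite lerDr expr0 mcoeff1 ler0n.
  - by apply: mpoly_leX; [exact: trunc_geom_nneg|exact: trunc_geom_le].
have -> : series_coef (mnm_add alpha (mnm1 j)) =
    mcoeff (mnm_add alpha (mnm1 j)) (trunc_series N.+1).
  by rewrite trunc_series_stable // mdegD mdeg1 addn1.
apply: (@le_trans _ _ (mcoeff (mnm_add alpha (mnm1 j)) (P j * trunc_series N))); last first.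
  rewrite /trunc_series (bigD1 j) //= [in leRHS](bigD1 j) //= mulrA.
  apply: mpoly_leM.
  - by apply: mpoly_nnegM => //; exact/mpoly_nnegX/trunc_geom_nneg.
  - by apply: mpoly_nneg_prod => i; exact/mpoly_nnegX/trunc_geom_nneg.
  - exact: step.
  - apply: mpoly_le_prod => i; first exact/mpoly_nnegX/trunc_geom_nneg.
    by apply: mpoly_leX; [exact: trunc_geom_nneg|exact: trunc_geom_le].
(* Of [P j] only the linear term in the variable j is kept; the other coefficients are
   nonnegative. *)
have aX : mpoly_le (a *: mpolyX C (mnm1 j)) (P j).
  move=> beta; rewrite mcoeffZ mcoeffX; case: eqP => [<-|_]; rewrite ?mulr1 ?mulr0 //.
  exact: P_nneg.
have a0 : mpoly_nneg (a *: mpolyX C (mnm1 j)).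
  by move=> beta; rewrite mcoeffZ mcoeffX mulr_ge0 ?ler0n ?P_nneg.
apply: le_trans (mpoly_leM a0 (trunc_series_nneg N) aX (fun=> lexx _) _).
by rewrite -scalerAl mcoeffZ -(commr_mpolyX _ (trunc_series N)) [mnm_add alpha _]addmC mcoeffMX.
Qed.

End PowerSeries.
(** * Averages over roots of unity *)

Section RootsOfUnity.
Context {F : numClosedFieldType}.

(** X^N - 1 splits and is separable in characteristic 0, so it has N distinct roots, enough to force
    a primitive one. *)
Lemma prim_root_exists (N : nat) : (0 < N)%N -> exists w : F, N.-primitive_root w.
Proof.
move=> N0; pose p : {poly F} := 'X^N - 1; have [r Dp] := closed_field_poly_normal p.
rewrite (monicP _) ?monicXnsubC // scale1r in Dp.
have rN1 : all N.-unity_root r by apply/allP => z; rewrite -root_prod_XsubC -Dp.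
have sz_r : (N < (size r).+1)%N.
  by rewrite -(size_prod_XsubC r id) -Dp size_XnsubC.
have [|z _ prz] := hasP (has_prim_root N0 rN1 _ sz_r); last by exists z.
by rewrite -separable_prod_XsubC -Dp separable_Xn_sub_1 // pnatr_eq0 -lt0n.
Qed.

Lemma norm_prim_root (N : nat) (w : F) : N.-primitive_root w -> `|w| = 1.
Proof.
move=> prw; apply/eqP; rewrite -(@pexpr_eq1 _ _ N) ?(prim_order_gt0 prw) //.
by rewrite -normrX (prim_expr_order prw) normr1.
Qed.

Lemma prim_root_ortho (N : nat) (w : F) (a b : nat) : N.-primitive_root w ->
  \sum_(i < N) ((w ^+ i) ^+ a)^* * (w ^+ i) ^+ b =
  if (a == b %[mod N])%N then N%:R else 0.
Proof.
move=> prw; have w0 : w != 0 by rewrite -normr_eq0 (norm_prim_root prw) oner_eq0.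
have wJ : w^* = w^-1 by rewrite invC_norm (norm_prim_root prw) expr1n invr1 mul1r.
pose t := w ^+ b / w ^+ a.
rewrite (eq_bigr (fun i : 'I_N => t ^+ i)) => [|i _]; last first.
  rewrite !conjX wJ /t expr_div_n -!exprM mulrC -exprVn ![(i * _)%N]mulnC.
  by rewrite !exprM !exprVn.
rewrite eq_sym -(eq_prim_root_expr prw); case: eqP => [E|/eqP E].
  rewrite (eq_bigr (fun=> 1)) => [|i _]; last by rewrite /t E divff ?expf_neq0 ?expr1n.
  by rewrite sumr_const card_ord.
apply: (mulfI (_ : t - 1 != 0)).
  rewrite subr_eq0 /t; apply: contraNneq E => E; apply/eqP.
  by rewrite -[LHS](divfK (expf_neq0 a w0)) E mul1r.
rewrite mulr0 -subrX1 /t expr_div_n -!exprM ![(_ * N)%N]mulnC !exprM.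
by rewrite (prim_expr_order prw) !expr1n divr1 subrr.
Qed.

End RootsOfUnity.

(** * Extraction of coefficients by discrete tori *)

Section Torus.
Context {R : realType} {n : nat}.
Local Notation C := (R[i]%C).
Local Notation V := 'rV[C]_n.
Implicit Types (alpha beta : multinom n).

Definition mnm_eqmod (N : nat) alpha beta := [forall j, alpha j == beta j %[mod N]].

Lemma mnm_eqmod_refl N alpha : mnm_eqmod N alpha alpha.
Proof. by apply/forallP. Qed.

Lemma monomial_scale (r : C) (x : V) alpha :
  monomial (r *: x) alpha = r ^+ mdeg alpha * monomial x alpha.
Proof.
rewrite /monomial mdegE -prodrXr -big_split; apply: eq_bigr => j _ /=.
by rewrite mxE exprMn.
Qed.

(** A finite substitute for integration over the torus: the points are the n-tuples of N-th roots of
    unity, so monomials are orthogonal only up to congruence of exponents modulo N. *)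
Lemma torus_average (N : nat) : (0 < N)%N -> exists (T : finType) (z : T -> V),
  (forall t j, `|z t 0 j| = 1) /\
  forall alpha beta, \sum_t #|T|%:R^-1 * (monomial (z t) alpha)^* * monomial (z t) beta =
    (mnm_eqmod N alpha beta)%:R.
Proof.
move=> N0; have [w prw] := @prim_root_exists (R[i]%C) N N0.
exists {ffun 'I_n -> 'I_N}, (fun k : {ffun 'I_n -> 'I_N} => \row_j w ^+ k j).
split=> [k j|alpha beta].
  by rewrite mxE normrX (norm_prim_root prw) expr1n.
pose z (k : {ffun 'I_n -> 'I_N}) : V := \row_j w ^+ k j.
have Ez k : (monomial (z k) alpha)^* * monomial (z k) beta =
    \prod_j (((w ^+ k j) ^+ alpha j)^* * (w ^+ k j) ^+ beta j).
  rewrite {1}/monomial conj_prod -big_split.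
  by apply: eq_bigr => j _; rewrite !mxE.
under eq_bigr => k _ do rewrite -mulrA Ez.
rewrite -mulr_sumr -(bigA_distr_bigA (fun (j : 'I_n) (i : 'I_N) =>
   ((w ^+ i) ^+ alpha j)^* * (w ^+ i) ^+ beta j)) /=.
rewrite card_ffun !card_ord.
under eq_bigr => j _ do rewrite (prim_root_ortho _ _ prw).
rewrite /mnm_eqmod; case: forallP => [E|/forallP].
  rewrite (eq_bigr (fun=> N%:R)) => [|j _]; last by rewrite E.
  by rewrite prodr_const card_ord natrX mulVf // expf_neq0 // pnatr_eq0 -lt0n.
by rewrite negb_forall => /existsP[j /negPf Ej]; rewrite (bigD1 j) //= Ej mul0r mulr0.
Qed.

(** Finite sums off some finite set [F0] are small. [N] exceeds every entry of [alpha] and of the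
    members of [F0], so an exponent congruent to [alpha] but distinct from it lies outside [F0]. *)
Lemma has_sum_alias (b : multinom n -> C) (l : C) alpha (e : C) : has_sum b l -> 0 < e ->
  exists2 N, (0 < N)%N & forall A : {fset multinom n},
    `|\sum_(beta <- A | mnm_eqmod N alpha beta && (beta != alpha)) b beta| < e.
Proof.
move=> bl e0; have [F0 hF0] := has_sum_tail bl e0.
pose N := (\sum_(beta <- F0) mdeg beta + mdeg alpha).+1; exists N => // A.
rewrite big_fset_condE; apply: hF0; apply/fdisjointP => beta bF0.
rewrite !inE /=; apply/negP => /andP[_ /andP[/forallP E /eqP]]; apply.
have le_mdeg (gamma : multinom n) j : (gamma j <= mdeg gamma)%N.
  by rewrite mdegE (bigD1 j) //= leq_addr.
apply/mnmP => j; have := E j; rewrite !modn_small.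
- by move/eqP.
- by rewrite ltnS (leq_trans (le_mdeg beta j)) // (big_fsetD1 beta) //= -addnA leq_addr.
- by rewrite ltnS (leq_trans (le_mdeg alpha j)) // leq_addl.
Qed.

(** Averaging against the conjugate of the monomial at [alpha] over a discrete torus of radius [r]
    leaves the sum of [B beta * r ^+ mdeg beta] over [beta] congruent to [alpha], which is 0. By
    [has_sum_alias] all of it but the term at [alpha] is small. *)
Lemma power_series_eq0 (B : multinom n -> C) (r : C) : 0 < r ->
  (forall x : V, (forall j, `|x 0 j| = r) ->
     has_sum (fun alpha => B alpha * monomial x alpha) 0) ->
  B =1 fun=> 0.
Proof.
move=> r0 B0 alpha; pose b beta := B beta * r ^+ mdeg beta.
(* Summability of [b] is the hypothesis at the point whose coordinates all equal [r]. *)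
have br : has_sum b 0.
  pose x : V := r *: \row_j 1.
  apply: eq_has_sum (B0 x _) => [beta|j]; last by rewrite !mxE mulr1 gtr0_norm.
  rewrite /x monomial_scale /monomial big1 ?mulr1 // => j _.
  by rewrite mxE expr1n.
suff : b alpha = 0.
  by move/eqP; rewrite mulf_eq0 expf_eq0 (gt_eqF r0) andbF orbF => /eqP.
apply: (@eq0_small _ _ _ 2) => // e e0.
have [N N0 hN] := has_sum_alias alpha br e0.
have [T [z [z1 zavg]]] := torus_average N0.
have bavg : has_sum (fun beta => (mnm_eqmod N alpha beta)%:R * b beta) 0.
  have := @has_sum_sum _ _ _ (index_enum T) (fun t beta => #|T|%:R^-1 *
    (monomial (z t) alpha)^* * (B beta * monomial (r *: z t) beta))
    (fun t => #|T|%:R^-1 * (monomial (z t) alpha)^* * 0).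
  rewrite big1 => [H|t _]; last by rewrite mulr0.
  apply: eq_has_sum (H _) => [beta|t]; last first.
    by apply: has_sumZ; apply: B0 => j; rewrite mxE normrM z1 mulr1 gtr0_norm.
  rewrite -zavg mulr_suml; apply: eq_bigr => t _.
  by rewrite monomial_scale /b; ring.
have [F hF] := bavg e e0.
have := hF (F `|` [fset alpha])%fset (fsubsetUl _ _); rewrite subr0.
set G := (F `|` _)%fset; have aG : alpha \in G by rewrite !inE eqxx orbT.
rewrite (bigID (mnm_eqmod N alpha)) /= [X in _ + X]big1 => [|beta /negPf->]; last first.
  by rewrite mul0r.
rewrite addr0 (eq_bigr b) => [|beta ->]; last by rewrite mul1r.
rewrite (bigID (pred1 alpha)) /= (_ : \sum_(i <- G | _ && (i == alpha)) b i = b alpha).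
  move=> h1; set s := \sum_(i <- G | _) _ in h1.
  rewrite (_ : b alpha = (b alpha + s) - s); last by ring.
  apply: le_trans (ler_normB _ _) _; rewrite mulrDl mul1r lerD // ltW //; exact: hN.
rewrite (eq_bigl (pred1 alpha)) => [|beta] /=.
  by rewrite -big_filter (filter_pred1_uniq (fset_uniq G) aG) big_seq1.
by case: eqP => [->|]; rewrite ?andbF ?mnm_eqmod_refl.
Qed.

End Torus.
(** * Reproducing kernel Hilbert spaces *)

Section Closure.
Context {R : realType} {H : completeNormedModType R[i]%C}
  (ip : {dot H for Num.conj}).
Local Notation C := (R[i]%C).
Hypothesis ip_hilbert : hilbert ip.

Lemma closure_orthogonal (X : set H) (g h : H) :
  (forall u, X u -> ip u g = 0) -> closure X h -> ip h g = 0.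
Proof.
move=> Xg Xh; apply: (@eq0_small _ _ _ `|g|) => // e e0.
have [u [Xu hu]] := Xh _ (nbhsx_ballx h e e0).
rewrite (_ : ip h g = ip (h - u) g); last by rewrite ipBl (Xg u Xu) subr0.
apply: le_trans (cauchy_schwarz ip_hilbert _ _) _; rewrite mulrC ler_wpM2l //.
by move: hu; rewrite -ball_normE => /ltW.
Qed.

Lemma span_sub (A : set H) (u : H) : A u -> Defs.span A u.
Proof.
move=> Au; exists [:: (1, u)]; last by rewrite big_seq1 scale1r.
by move=> p; rewrite inE => /eqP->.
Qed.

Lemma span_linear (A : set H) (a : C) (u v : H) :
  Defs.span A u -> Defs.span A v -> Defs.span A (a *: u + v).
Proof.
move=> [s sA ->] [t tA ->]; exists ([seq (a * p.1, p.2) | p <- s] ++ t).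
  by move=> p; rewrite mem_cat => /orP[/mapP[q /sA Aq ->]|/tA].
rewrite big_cat big_map scaler_sumr /=; congr (_ + _).
by apply: eq_bigr => p _; rewrite scalerA.
Qed.

Lemma span_orthogonal (A : set H) (g u : H) :
  (forall v, A v -> ip v g = 0) -> Defs.span A u -> ip u g = 0.
Proof.
move=> Ag [s sA ->]; rewrite ip_suml big_seq big1 // => p /sA Ap.
by rewrite ipZl Ag ?mulr0.
Qed.

(** Riesz for the functional [ip _ f] restricted to the span: the representing vector is a limit of
    elements of the span, and is the orthogonal projection of [f]. *)
Lemma proj_closed_span (A : set H) (f : H) :
  exists2 h, closed_span A h & forall u, A u -> ip u h = ip u f.
Proof.
have [|a u _ v _ [Au ->] [Av ->]|//|u _ [_ ->]|h [hip _ hA]] := @riesz_graph _ _ ip ip_hilbert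
  (fun u x => Defs.span A u /\ x = ip u f) `|f|.
- by split; [exists [::]; rewrite ?big_nil|rewrite ip0l].
- by split; [exact: span_linear|rewrite ipDl ipZl].
- by rewrite mulrC; exact: cauchy_schwarz.
exists h.
  move=> U /hA [u [[x [Au _]] Uu]]; exists u; split => //.
by move=> u Au; apply: hip; split; first exact: span_sub.
Qed.

Lemma adjointE (T : H -> H) (f h : H) :
  (forall g, ip (T g) f = ip g h) -> adjoint ip T f = h.
Proof.
move=> Tfh; rewrite /adjoint; case: xgetP => [k _ Tfk|/(_ h)] //.
apply/eqP; rewrite -subr_eq0 -normr_eq0 -sqrf_eq0 -ip_hilbert ipBr.
by rewrite -Tfk -Tfh subrr.
Qed.

Lemma adjointP (T : H -> H) (M : C) : 0 <= M ->
  (forall a f g, T (a *: f + g) = a *: T f + T g) -> (forall f, `|T f| <= M * `|f|) ->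
  forall f g, ip (T g) f = ip g (adjoint ip T f).
Proof.
move=> M0 Tlin Tb f; suff [h Th] : exists h, forall g, ip (T g) f = ip g h.
  by rewrite (adjointE Th).
have [|a u x v y -> ->||u x ->|h [hip _ _]] := @riesz_graph _ _ ip ip_hilbert
  (fun u x => x = ip (T u) f) (`|f| * M).
- have := Tlin (-1) 0 0; rewrite scaler0 addr0 scaleN1r => E.
  by rewrite -[T 0]addr0 [T 0 + 0]addr0 E addNr ip0l.
- by rewrite Tlin ipDl ipZl.
- by rewrite mulr_ge0.
- rewrite -mulrA mulrC; apply: le_trans (cauchy_schwarz ip_hilbert _ _) _.
  by rewrite ler_wpM2r.
by exists h => g; rewrite (hip g _ erefl).
Qed.

End Closure.

(** * Orthonormal basis and multipliers from a kernel expansion *)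

Section KernelExpansion.
Context {R : realType} {n : nat} {H : completeNormedModType R[i]%C}
  {D : set 'rV[R[i]%C]_n}.
Local Notation C := (R[i]%C).
Local Notation V := 'rV[C]_n.
Context {K : V -> V -> C} {ip : {dot H for Num.conj}} {ev : H -> V -> C}.
Hypothesis HK : is_rkhs D K ip ev.
Let ip_hilbert : hilbert ip := rkhs_hilbert HK.

Lemma eltE (g : V -> C) (h : H) : (forall z, D z -> ev h z = g z) -> elt D ev g = h.
Proof.
move=> hg; rewrite /elt; case: xgetP => [k _ kg|/(_ h)] //.
by apply: (rkhs_inj HK) => z Dz; rewrite kg ?hg.
Qed.

Lemma ev_linear (a : C) f g z : D z -> ev (a *: f + g) z = a * ev f z + ev g z.
Proof. exact: (rkhs_linear HK). Qed.

Lemma ev0 z : D z -> ev 0 z = 0.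
Proof.
move=> Dz; have := ev_linear (-1) 0 0 Dz.
by rewrite scaler0 addr0 mulN1r addNr.
Qed.

Lemma evZ (a : C) f z : D z -> ev (a *: f) z = a * ev f z.
Proof. by move=> Dz; rewrite -[a *: f]addr0 ev_linear // ev0 // addr0. Qed.

Definition kfun w := elt D ev (fun z => K z w).

Lemma kfunP w : D w ->
  (forall z, D z -> ev (kfun w) z = K z w) /\ forall f, ev f w = ip f (kfun w).
Proof. by move=> Dw; have [k kK kip] := rkhs_reproducing HK Dw; rewrite /kfun (eltE kK). Qed.

Lemma ev_kfun z w : D w -> D z -> ev (kfun w) z = K z w.
Proof. by move=> /kfunP[+ _] Dz; apply. Qed.

Lemma reproducing f w : D w -> ev f w = ip f (kfun w).
Proof. by move=> /kfunP[_]. Qed.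

Lemma mulop_linear j (a : C) f g :
  (forall f, exists h, forall z, D z -> ev h z = z 0 j * ev f z) ->
  mulop D ev j (a *: f + g) = a *: mulop D ev j f + mulop D ev j g.
Proof.
move=> mult; have [hf Hf] := mult f; have [hg Hg] := mult g.
rewrite /mulop (eltE Hf) (eltE Hg); apply: eltE => z Dz.
by rewrite !ev_linear // Hf // Hg //; ring.
Qed.

Context {I : choiceType}.
Variable e : I -> V -> C.
Hypothesis K_expansion : forall z w, D z -> D w ->
  has_sum (fun a => e a z * (e a w)^*) (K z w).
Implicit Types (s : seq (C * {z | D z})).

Definition kcomb s : H := \sum_(p <- s) p.1 *: kfun (sval p.2).
Definition kcoef s a : C := \sum_(p <- s) p.1 * (e a (sval p.2))^*.

(** [ip (kfun z) (kfun w)] is K(w, z), and expanding it turns the squared norm into a sum of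
    squares. This is Parseval's identity, available before the functions [e a] are known to lie in
    [H]. *)
Lemma norm_kcomb s : has_sum (fun a => `|kcoef s a| ^+ 2) (`|kcomb s| ^+ 2).
Proof.
rewrite -ip_hilbert /kcomb ip_suml.
apply: (@eq_has_sum _ _ (fun a => \sum_(p <- s) \sum_(q <- s)
   p.1 * q.1^* * (e a (sval q.2) * (e a (sval p.2))^*))) => [a|].
  rewrite normCK /kcoef conj_sum mulr_suml; apply: eq_bigr => p _.
  by rewrite mulr_sumr; apply: eq_bigr => q _; rewrite !conjE; ring.
apply: has_sum_sum => p; rewrite ip_sumr; apply: has_sum_sum => q.
rewrite ipZl ipZr mulrA; apply: has_sumZ.
by rewrite -reproducing ?ev_kfun; [apply: K_expansion| | |]; exact: svalP.
Qed.

Lemma kcoef_sum_le s (F : {fset I}) : \sum_(a <- F) `|kcoef s a| ^+ 2 <= `|kcomb s| ^+ 2.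
Proof.
apply: has_sum_ge (norm_kcomb s) => [a|]; first by rewrite exprn_ge0.
by rewrite ger0_real ?exprn_ge0.
Qed.

(** Kernels may be linearly dependent, so the prescribed values give at first only a relation
    between combinations and scalars. The bound makes it single valued, and Riesz for graphs
    applies. *)
Lemma extend_kernel (c : {z | D z} -> C) (B : C) : 0 <= B ->
  (forall s, `|\sum_(p <- s) p.1 * c p.2| <= B * `|kcomb s|) ->
  exists2 h, (forall z, ev h (sval z) = (c z)^*) & `|h| <= B.
Proof.
move=> B0 Bc.
have [|a u x v y [s [-> ->]] [t [-> ->]]|//|u x [s [-> ->]]|h [hip hB _]] :=
  @riesz_graph _ _ ip ip_hilbert
  (fun u x => exists s, u = kcomb s /\ x = \sum_(p <- s) p.1 * c p.2) B.
- by exists [::]; rewrite /kcomb !big_nil.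
- exists ([seq (a * p.1, p.2) | p <- s] ++ t).
  rewrite /kcomb !big_cat !big_map scaler_sumr mulr_sumr /=.
  split; congr (_ + _); apply: eq_bigr => p _; by rewrite ?scalerA ?mulrA.
- exact: Bc.
exists h => // z; rewrite reproducing; last exact: svalP.
rewrite ipC; congr (_^*); apply: hip.
by exists [:: (1, z)]; rewrite /kcomb !big_seq1 scale1r mul1r.
Qed.

Definition ebasis a := elt D ev (e a).

(** One term of Parseval's identity is at most the whole sum, so the functional induced by [e a] is
    bounded by 1. *)
Lemma ebasisP a : (forall z, D z -> ev (ebasis a) z = e a z) /\ `|ebasis a| <= 1.
Proof.
have [||h hev h1] := @extend_kernel (fun z => (e a (sval z))^*) 1 => [//|s|].
  rewrite mul1r -(ler_pXn2r (ltn0Sn 1)) ?nnegrE //.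
  by have := kcoef_sum_le s [fset a]%fset; rewrite big_seq_fset1.
have he z : D z -> ev h z = e a z.
  by move=> Dz; have := hev (exist _ z Dz); rewrite conjCK.
by rewrite /ebasis (eltE he).
Qed.

Lemma ev_ebasis a z : D z -> ev (ebasis a) z = e a z.
Proof. by case: (ebasisP a) => + _; apply. Qed.

Lemma ip_kfun_ebasis a z : D z -> ip (kfun z) (ebasis a) = (e a z)^*.
Proof. by move=> Dz; rewrite ipC -reproducing // ev_ebasis. Qed.

Lemma ip_kcomb_ebasis a s : ip (kcomb s) (ebasis a) = kcoef s a.
Proof.
rewrite ip_suml; apply: eq_bigr => p _; rewrite ipZl ip_kfun_ebasis //.
exact: svalP.
Qed.

(** The adjoint of multiplication by [mu] sends the kernel at z to conj(mu(z)) times itself. On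
    coefficients of a combination this reads [(r a)^* * kcoef s (sigma a)]; as [sigma] is injective,
    no coefficient of [s] is counted twice, and Parseval gives the bound [M]. *)
Lemma weighted_shift_multiplier (mu : V -> C) (sigma : I -> I) (r : I -> C) (M : C) :
  injective sigma -> 0 <= M -> (forall a, `|r a| <= M) ->
  (forall a z, D z -> mu z * e a z = r a * e (sigma a) z) ->
  forall g, exists2 h, (forall z, D z -> ev h z = mu z * ev g z) & `|h| <= M * `|g|.
Proof.
move=> sigma_inj M0 rM mue g.
have [||h hev hM] := @extend_kernel (fun z => (mu (sval z) * ev g (sval z))^*) (M * `|g|).
- by rewrite mulr_ge0.
- move=> s; pose t := [seq (p.1 * (mu (sval p.2))^*, p.2) | p <- s].
  have -> : \sum_(p <- s) p.1 * (mu (sval p.2) * ev g (sval p.2))^* = ip (kcomb t) g.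
    rewrite ip_suml big_map; apply: eq_bigr => p _ /=.
    by rewrite ipZl conjM (@reproducing g) ?[ip g _]ipC ?conjCK ?mulrA //; exact: svalP.
  rewrite mulrAC; apply: le_trans (cauchy_schwarz ip_hilbert _ _) _.
  rewrite ler_wpM2r // -(ler_pXn2r (ltn0Sn 1)) ?nnegrE ?mulr_ge0 //.
  apply: (has_sum_le _ _ (norm_kcomb t)); rewrite ?ger0_real ?exprn_ge0 ?mulr_ge0 // => F.
  have kt a : kcoef t a = (r a)^* * kcoef s (sigma a).
    rewrite /kcoef big_map mulr_sumr; apply: eq_bigr => p _ /=.
    rewrite -mulrA -conjM mue; last exact: svalP.
    by rewrite conjM; ring.
  have Fs := kcoef_sum_le s (sigma @` F)%fset.
  rewrite big_imfset /= in Fs; last by move=> a b _ _; exact: sigma_inj.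
  rewrite exprMn; apply: le_trans (ler_wpM2l (exprn_ge0 2 M0) Fs).
  rewrite mulr_sumr; apply: ler_sum => a _; rewrite kt normrM exprMn norm_conjC.
  by rewrite ler_wpM2r ?exprn_ge0 // lerXn2r ?nnegrE.
exists h => // z Dz.
by have := hev (exist _ z Dz); rewrite conjCK.
Qed.

(* Approximately isolating the coefficient [b] with a combination of kernels of
   norm close to [1] forces the [ebasis a] to be orthonormal. *)
Hypothesis isolate : forall b (d : C), 0 < d -> exists s, kcoef s b = 1 /\
  forall F : {fset I}, \sum_(a <- F) `|kcoef s a| ^+ 2 <= 1 + d.

(** As [ip (kcomb s) (ebasis b)] is 1, the last left-hand side equals |kcomb s|^2 - 1. Both of its
    summands are nonnegative, since [ebasis b] has norm at most 1, so one bound controls the norm of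
    [ebasis b] and its distance to [kcomb s]. *)
Lemma isolate_ebasis b (d : C) : 0 < d -> exists s,
  [/\ kcoef s b = 1, `|kcomb s| ^+ 2 <= 1 + d &
      `|kcomb s - ebasis b| ^+ 2 + (1 - `|ebasis b| ^+ 2) <= d].
Proof.
move=> d0; have [s [sb sF]] := isolate b d0; exists s.
have s1 : `|kcomb s| ^+ 2 <= 1 + d.
  apply: (has_sum_le _ _ (norm_kcomb s) sF).
    by rewrite ger0_real ?exprn_ge0.
  by rewrite realD ?(gtr0_real d0).
split=> //; rewrite (sqnormB ip_hilbert) ip_kcomb_ebasis sb conjC1.
rewrite (_ : _ + _ = `|kcomb s| ^+ 2 - 1); last by ring.
by rewrite lerBlDl.
Qed.

Lemma ebasis_orthonormal a b : ip (ebasis a) (ebasis b) = (a == b)%:R.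
Proof.
have sq1 c : `|ebasis c| ^+ 2 <= 1 by rewrite expr_le1 //; case: (ebasisP c).
case: eqP => [<-|/eqP ab].
  rewrite ip_hilbert (_ : true%:R = 1 :> C) //.
  apply/eqP; rewrite eq_sym -subr_eq0; apply/eqP.
  apply: (@eq0_small _ _ _ 1) => // d d0; rewrite mul1r ger0_norm ?subr_ge0 //.
  have [s [_ _]] := isolate_ebasis a d0; apply: le_trans.
  by rewrite lerDr exprn_ge0.
rewrite (_ : false%:R = 0 :> C) //.
apply: (@eq0_small _ _ _ 2) => // d d0.
have [s [sb s1 sd]] := isolate_ebasis b (exprn_gt0 2 d0).
have l1 : `|kcomb s - ebasis b| <= d.
  rewrite -(ler_pXn2r (ltn0Sn 1)) ?nnegrE ?(ltW d0) //.
  by apply: le_trans sd; rewrite lerDl subr_ge0.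
(* The coefficient 1 at [b] leaves at most [d ^+ 2] of the total [1 + d ^+ 2] for any other
   coefficient. *)
have l2 : `|kcoef s a| <= d.
  rewrite -(ler_pXn2r (ltn0Sn 1)) ?nnegrE ?(ltW d0) // -(lerD2l 1).
  apply: le_trans s1; apply: le_trans (kcoef_sum_le s [fset b; a]%fset).
  rewrite big_fsetU1 ?inE 1?eq_sym // big_seq_fset1 sb normr1 expr1n.
  exact: lexx.
rewrite ipC norm_conjC.
rewrite (_ : ip (ebasis b) (ebasis a) =
  ip (kcomb s) (ebasis a) - ip (kcomb s - ebasis b) (ebasis a)); last first.
  by rewrite ipBl; ring.
rewrite ip_kcomb_ebasis; apply: le_trans (ler_normB _ _) _.
rewrite mulrDl mul1r lerD //; apply: le_trans (cauchy_schwarz ip_hilbert _ _) _.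
apply: le_trans (_ : d * 1 <= _); last by rewrite mulr1.
by apply: ler_pM => //; case: (ebasisP a).
Qed.

(** For the partial sum [S], both [ip (kfun z) S] and [ip S S] equal the partial sum [T] of the
    expansion of K(z, z), so the squared distance is K(z, z) - T. *)
Lemma kfun_expansion z (d : C) : D z -> 0 < d -> exists F0 : {fset I},
  forall F : {fset I}, (F0 `<=` F)%fset ->
  `|kfun z - \sum_(a <- F) (e a z)^* *: ebasis a| ^+ 2 < d.
Proof.
move=> Dz d0; have [F0 hF0] := K_expansion Dz Dz d0; exists F0 => F /hF0.
set S := \sum_(a <- F) _ *: _; set T := \sum_(a <- F) _ * _ => hT.
have kS : ip (kfun z) S = T.
  rewrite ip_sumr; apply: eq_bigr => a _.
  by rewrite ipZr conjCK ip_kfun_ebasis.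
have SS : ip S S = T.
  rewrite ip_suml; apply: eq_big_seq => a aF; rewrite ipZl mulrC ip_sumr; congr (_ * _).
  rewrite (big_fsetD1 a) //= ipZr ebasis_orthonormal eqxx conjCK mulr1.
  rewrite big1_seq ?addr0 // => b /=; rewrite !inE => /andP[ba _].
  by rewrite ipZr ebasis_orthonormal eq_sym (negPf ba) mulr0.
have T0 : 0 <= T by rewrite -SS ip_hilbert exprn_ge0.
rewrite (sqnormB ip_hilbert) -!ip_hilbert SS kS geC0_conj //.
rewrite -reproducing // ev_kfun //.
rewrite (_ : _ - _ = - (T - K z z)); last by ring.
apply: le_lt_trans hT; rewrite -normrN; apply: real_ler_norm.
by rewrite realN realB ?ger0_real // -ev_kfun // reproducing // ip_hilbert exprn_ge0.
Qed.

Lemma ev_expansion f z : D z -> has_sum (fun a => ip f (ebasis a) * e a z) (ev f z).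
Proof.
move=> Dz d d0; have f1 : 0 < `|f| + 1 by rewrite ltr_wpDl.
have [|F0 hF0] := @kfun_expansion z ((d / (`|f| + 1)) ^+ 2) Dz.
  by rewrite exprn_gt0 // divr_gt0.
exists F0 => F /hF0; rewrite ltr_pXn2r ?nnegrE ?divr_ge0 ?(ltW d0) ?(ltW f1) //.
set S := \sum_(a <- F) _ *: _ => hS.
rewrite (_ : \sum_(a <- F) _ = ip f S); last first.
  by rewrite ip_sumr; apply: eq_bigr => a _; rewrite ipZr conjCK mulrC.
rewrite reproducing // -ipBr; apply: le_lt_trans (cauchy_schwarz ip_hilbert _ _) _.
apply: le_lt_trans (_ : (`|f| + 1) * `|S - kfun z| < _).
  by rewrite ler_wpM2r // lerDl.
by rewrite mulrC -ltr_pdivlMr // distrC.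
Qed.

Lemma ebasis_total f : (forall a, ip f (ebasis a) = 0) -> f = 0.
Proof.
move=> f0; apply: (rkhs_inj HK) => z Dz; rewrite ev0 //.
apply: has_sum_unique (ev_expansion f Dz) _.
by apply: eq_has_sum (@has_sum0 _ _) => a; rewrite f0 mul0r.
Qed.

(** For the converse, [f] minus its projection is orthogonal to every [ebasis a]: by projection if
    [a] is in [A], and otherwise because both coefficients vanish. *)
Lemma closed_span_ebasis (A : set I) f :
  closed_span [set ebasis a | a in A] f <-> (forall a, ~ A a -> ip f (ebasis a) = 0).
Proof.
split=> [Af a nAa|fA].
  apply: (closure_orthogonal ip_hilbert) Af => u; apply: span_orthogonal => _ [b Ab <-].
  by rewrite ebasis_orthonormal; case: eqP => // E; case: nAa; rewrite -E.
have [h Ah hf] := proj_closed_span ip_hilbert [set ebasis a | a in A] f.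
suff -> : f = h by [].
apply/eqP; rewrite -subr_eq0; apply/eqP/ebasis_total => a; rewrite ipBl.
have [Aa|nAa] := pselect (A a).
  by rewrite ipC -hf; [rewrite -ipC subrr|exists a].
rewrite fA // sub0r; apply/eqP; rewrite oppr_eq0; apply/eqP.
apply: (closure_orthogonal ip_hilbert) Ah => u; apply: span_orthogonal => _ [b Ab <-].
by rewrite ebasis_orthonormal; case: eqP => // E; case: nAa; rewrite -E.
Qed.

End KernelExpansion.
(** * The triangle *)

Section Multinomials.
Context {n : nat}.
Implicit Types (alpha beta : multinom n).

Lemma mnm_ind (Q : multinom n -> Prop) : Q (@mnm0 n) ->
  (forall alpha j, Q alpha -> Q (mnm_add alpha (mnm1 j))) -> forall alpha, Q alpha.
Proof.
move=> Q0 QS alpha; have [d] := ubnP (mdeg alpha); elim: d alpha => // d IHd alpha.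
have [->//|] := eqVneq alpha mnm0; rewrite -mdeg_eq0 mdegE => a0 ad.
have [j aj] : exists j, alpha j != 0%N.
  apply/existsP; rewrite -negb_forall; apply: contra a0 => /forallP a0.
  by rewrite big1 // => j _; apply/eqP/a0.
have E : alpha = mnm_add (mnm_sub alpha (mnm1 j)) (mnm1 j).
  apply/mnmP => i; rewrite mnmDE mnmBE subnK // mnm1E.
  by case: eqP => // <-; rewrite lt0n.
rewrite E; apply: QS; apply: IHd; move: ad; rewrite -mdegE {1}E mdegD mdeg1 addn1.
by rewrite ltnS.
Qed.

Lemma big_tail (T : Type) (idx : T) (op : Monoid.com_law idx) (f : 'I_n -> T) (j : 'I_n) :
  \big[op/idx]_(i < n | (j <= i)%N) f i = op (f j) (\big[op/idx]_(i < n | (j < i)%N) f i).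
Proof.
rewrite (bigD1 j) //=; congr (op _ _); apply: eq_bigl => i.
by rewrite ltn_neqAle eq_sym andbC.
Qed.

Lemma last_ltF (i j : 'I_n) : j.+1 = n -> (j < i)%N = false.
Proof. by move=> jn; rewrite ltnNge -ltnS jn ltn_ord. Qed.

Definition mnm_tail (j : 'I_n) : multinom n := \big[@mnm_add n/@mnm0 n]_(i < n | (j <= i)%N) mnm1 i.

Lemma mnm_tail_last (j : 'I_n) : j.+1 = n -> mnm_tail j = mnm1 j.
Proof.
move=> jn; rewrite /mnm_tail big_tail big_pred0 => [|i]; first exact: addm0.
exact: last_ltF.
Qed.

Lemma mnm_tail_next (j k : 'I_n) : k = j.+1 :> nat ->
  mnm_tail j = mnm_add (mnm1 j) (mnm_tail k).
Proof. by move=> kj; rewrite /mnm_tail big_tail kj. Qed.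

Lemma mnm_tail_at (j k : 'I_n) : (j <= k)%N -> mnm_tail j k != 0%N.
Proof.
by move=> jk; rewrite mnm_sumE (bigD1 k) //= mnm1E eqxx.
Qed.

End Multinomials.

Lemma real_mul_le_mean (F : numFieldType) (a b : F) :
  a \is Num.real -> b \is Num.real -> a * b <= (a ^+ 2 + b ^+ 2) / 2.
Proof.
move=> ar br; rewrite ler_pdivlMr // -subr_ge0.
rewrite (_ : _ - _ = (a - b) ^+ 2); last by ring.
by rewrite -realEsqr realB.
Qed.

(** * The coordinates x = phi(z) *)

Section TriangleCoordinates.
Context {R : realType} {n : nat}.
Local Notation C := (R[i]%C).
Local Notation V := 'rV[C]_n.
Implicit Types (x z w : V) (alpha : multinom n).

Definition phi_inv x : V := \row_(j < n) \prod_(i < n | (j <= i)%N) x 0 i.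

Lemma phi_next z (j k : 'I_n) : k = j.+1 :> nat -> phi z 0 j = z 0 j / z 0 k.
Proof.
move=> kj; rewrite mxE; case: insubP => [k' _ k'j|]; last by rewrite -kj ltn_ord.
by congr (_ / z 0 _); apply: val_inj; rewrite k'j; exact: esym kj.
Qed.

Lemma phi_last z (j : 'I_n) : j.+1 = n -> phi z 0 j = z 0 j.
Proof. by move=> jn; rewrite mxE insubN // jn ltnn. Qed.

Lemma ord_nextP (j : 'I_n) : (exists k : 'I_n, k = j.+1 :> nat) \/ j.+1 = n.
Proof.
have := ltn_ord j; rewrite leq_eqVlt => /orP[/eqP|jn]; first by right.
by left; exists (Ordinal jn).
Qed.

Lemma phi_invK x : (forall j, x 0 j != 0) -> phi (phi_inv x) = x.
Proof.
move=> x0; have p0 (Q : pred 'I_n) : \prod_(i < n | Q i) x 0 i != 0.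
  by apply/prodf_neq0 => i _; exact: x0.
apply/rowP => j; have [[k kj]|jn] := ord_nextP j.
  by rewrite (phi_next _ kj) !mxE (big_tail _ _ j) kj mulfK.
rewrite phi_last // mxE (big_tail _ _ j) big_pred0 => [|i]; first exact: mulr1.
exact: last_ltF.
Qed.

Lemma phiK z : punctured z -> forall j : 'I_n, z 0 j = \prod_(i < n | (j <= i)%N) phi z 0 i.
Proof.
move=> zp j; have [d] := ubnP (n - j); elim: d j => // d IHd j jd.
rewrite (big_tail _ _ j); have [[k kj]|jn] := ord_nextP j.
  have zk : z 0 k = \prod_(i < n | (j < i)%N) phi z 0 i.
    rewrite IHd; first by apply: eq_bigl => i; rewrite kj.
    by move: jd; rewrite kj; case: (n - j)%N (subnSK (ltn_ord j)) => // k' <- ; rewrite ltnS.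
  rewrite (phi_next _ kj); transitivity (z 0 j / z 0 k * z 0 k).
    by rewrite divfK // zp // kj.
  by rewrite {2}zk.
rewrite phi_last // big_pred0 => [|i]; first by rewrite [RHS]mulr1.
exact: last_ltF.
Qed.

Lemma monomial_tail x j : monomial x (mnm_tail j) = \prod_(i < n | (j <= i)%N) x 0 i.
Proof.
rewrite (big_morph (monomial x) (monomialD x) (monomial0 x)).
by apply: eq_bigr => i _; rewrite monomial1.
Qed.

Lemma phi_inv_punctured x : (forall j, x 0 j != 0) -> punctured (phi_inv x).
Proof. by move=> x0 j _; rewrite mxE; apply/prodf_neq0 => i _; exact: x0. Qed.

Lemma prod_tail_neq0 z : punctured z -> prod_tail z != 0.
Proof. by move=> zp; apply/prodf_neq0 => j; exact: zp. Qed.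

Lemma monomial_phi2 z w alpha :
  monomial (phi2 z w) alpha = monomial (phi z) alpha * (monomial (phi w) alpha)^*.
Proof.
rewrite {3}/monomial conj_prod -big_split; apply: eq_bigr => j _ /=.
by rewrite [phi2 z w 0 j]mxE exprMn conjX.
Qed.

(** Membership in the triangle bounds the P_j on the diagonal only, while the expansion of K(z, w)
    needs absolute convergence off it. The inequality of means, applied to each monomial, bridges
    the two. *)
Lemma peval_phi2_le (p : mpoly n C) z w : mpoly_nneg p ->
  peval p (entrywise_norm (phi2 z w)) <=
  (peval p (phi2 z z) + peval p (phi2 w w)) / 2.
Proof.
move=> p0; rewrite !pevalE -big_split /= mulr_suml; apply: ler_sum => alpha _.
rewrite -mulrDr -mulrA ler_wpM2l // -norm_monomial !monomial_phi2 -!normCK.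
by rewrite normrM norm_conjC real_mul_le_mean ?normr_real.
Qed.

End TriangleCoordinates.

Section SmallPolydisc.
Context {R : realType} {n : nat}.
Local Notation C := (R[i]%C).
Local Notation V := 'rV[C]_n.
Variable P : 'I_n -> mpoly n C.
Hypothesis P_nneg : forall j, mpoly_nneg (P j).
Hypothesis P_const : forall j, mcoeff (@mnm0 n) (P j) = 0.

(** [r] is the inverse of 1 plus the sum of all coefficients of all the P_j. As r <= 1, nonconstant
    monomials are at most [r], so P_j is at most r times the sum of its coefficients. *)
Lemma small_polydisc : exists2 r : C, 0 < r <= 1 &
  forall x : V, (forall j, `|x 0 j| <= r) ->
  forall j, peval (P j) (entrywise_norm x) < 1.
Proof.
pose S j : C := \sum_(alpha <- msupp (P j)) mcoeff alpha (P j).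
have S0 j : 0 <= S j by rewrite sumr_ge0 // => alpha _; exact: P_nneg.
have T0 : 0 <= \sum_j S j by rewrite sumr_ge0.
have T1 : 0 < 1 + \sum_j S j by rewrite ltr_pwDl.
have r0 : 0 < (1 + \sum_j S j)^-1 by rewrite invr_gt0.
have r1 : (1 + \sum_j S j)^-1 <= 1 by rewrite invf_le1 // lerDl.
have [r Er] : exists r, r = (1 + \sum_j S j)^-1 by exists (1 + \sum_j S j)^-1.
rewrite -Er in r0 r1; exists r; rewrite ?r0 // => x xr j.
apply: (@le_lt_trans _ _ (r * S j)).
  rewrite pevalE mulr_sumr; apply: ler_sum => alpha _; rewrite mulrC.
  have [->|a0] := eqVneq alpha mnm0; first by rewrite P_const !mulr0.
  rewrite ler_wpM2r ?P_nneg //.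
  apply: (@le_trans _ _ (r ^+ mdeg alpha)).
    rewrite mdegE -prodrXr; apply: ler_prod => k _; rewrite mxE exprn_ge0 //=.
    by rewrite lerXn2r ?nnegrE ?(ltW r0).
  rewrite -[leRHS]expr1; apply: ler_wiXn2l; rewrite ?(ltW r0) //.
  by rewrite lt0n mdeg_eq0.
rewrite Er mulrC ltr_pdivrMr // mul1r; apply: (@le_lt_trans _ _ (\sum_j S j)).
  by rewrite (bigD1 j) //= lerDl sumr_ge0.
by rewrite ltrDr.
Qed.

End SmallPolydisc.

(** * The coefficients A_(P,m)(alpha) *)

Section Coefficients.
Context {R : realType} {n : nat}.
Local Notation C := (R[i]%C).
Local Notation V := 'rV[C]_n.
Variables (P : 'I_n -> mpoly n C) (m : 'I_n -> nat).
Hypothesis P_reg : positive_regular P.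

Lemma positive_regular_nneg j : mpoly_nneg (P j).
Proof. by have [] := P_reg j. Qed.

Lemma positive_regular_low j alpha : (mdeg alpha <= 1)%N ->
  exists2 a : C, 0 < a & mcoeff alpha (P j) = a * (mnm1 j == alpha)%:R.
Proof.
move=> alpha1; have [_ [a [N [Q [a0 Qhom ->]]]]] := P_reg j; exists a => //.
rewrite mcoeffD mcoeffZ mcoeffX raddf_sum big1_seq ?addr0 // => k.
rewrite mem_index_iota => /andP[_ /andP[k2 kN]] /=.
apply: (dhomog_nemf_coeff (Qhom k _)); first by rewrite k2.
by rewrite neq_ltn (leq_ltn_trans alpha1).
Qed.

Lemma positive_regular_const j : mcoeff (@mnm0 n) (P j) = 0.
Proof.
have [|a _ ->] := @positive_regular_low j mnm0; first by rewrite mdeg0.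
by rewrite mnm1_eq0 mulr0.
Qed.

Lemma positive_regular_lin j : 0 < mcoeff (mnm1 j) (P j).
Proof.
have [|a a0 ->] := @positive_regular_low j (mnm1 j); first by rewrite mdeg1.
by rewrite eqxx mulr1.
Qed.

Let P_nneg := positive_regular_nneg.
Let P_const := positive_regular_const.

(** [series_coef] meets the condition under [xget], which excludes the default value; it is the only
    solution, since the difference of two sums to 0 on a small torus. *)
Lemma Acoef_series : Acoef P m = series_coef P m.
Proof.
have [r /andP[r0 _] hr] := small_polydisc P_nneg P_const.
have nearP (p : V -> Prop) : (forall x : V, (forall j, `|x 0 j| <= r) -> p x) ->
    \forall x \near (0 : 'rV[C^o]_n), p x.
  move=> hp; apply/nbhs_ballP; exists r => // x [_ x0]; apply: hp => j.
  have := x0 0 j; rewrite -ball_normE /= mxE sub0r normrN; exact: ltW.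
rewrite /Acoef; case: xgetP => [A _ /= HA|/(_ (series_coef P m))]; last first.
  by case; apply: nearP => x xr; apply/has_sumP; apply: has_sum_series => //; exact: hr.
have /nbhs_ballP[d /= d0 hd] := HA.
(* The radius must fit both the polydisc and the neighbourhood on which [A] is known to work;
   [d / 2] keeps the second inequality strict. *)
have [s s0 [sr sd]] : exists2 s : C, 0 < s & s <= r /\ s < d.
  have rr := gtr0_real r0; have dr : d / 2 \is Num.real by rewrite gtr0_real ?divr_gt0.
  have d2 : d / 2 < d by rewrite ltr_pdivrMr // mulr_natr mulr2n ltrDr.
  have [rd|dr'] := real_leP rr dr; first by exists r; rewrite ?(le_lt_trans rd).
  by exists (d / 2); rewrite ?divr_gt0 // (ltW dr').
apply/funext => alpha; apply/eqP; rewrite -subr_eq0; apply/eqP.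
apply: (power_series_eq0 (B := fun alpha => A alpha - series_coef P m alpha) s0) => x xs.
have S1 : has_sum (fun alpha => series_coef P m alpha * monomial x alpha) (series_fun P m x).
  by apply: has_sum_series => //; apply: hr => j; rewrite xs.
have S2 : has_sum (fun alpha => A alpha * monomial x alpha) (series_fun P m x).
  apply/has_sumP; apply: hd; split=> // i j; rewrite -ball_normE /= ord1 mxE sub0r normrN.
  by rewrite xs.
rewrite -(subrr (series_fun P m x)) -[X in _ - X]mul1r -mulNr.
by apply: eq_has_sum (has_sumD S2 (has_sumZ (-1) S1)) => beta; ring.
Qed.

Lemma Acoef0 : Acoef P m (@mnm0 n) = 1.
Proof. by rewrite Acoef_series series_coef0. Qed.

Lemma has_sum_Acoef (x : V) : (forall j, peval (P j) (entrywise_norm x) < 1) ->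
  has_sum (fun alpha => Acoef P m alpha * monomial x alpha) (series_fun P m x).
Proof. by move=> x1; rewrite Acoef_series; exact: has_sum_series. Qed.

Hypothesis m_gt0 : forall j, (0 < m j)%N.

(** The constant is the product of the linear coefficients a_j to the powers beta_j. With [alpha]
    zero this gives positivity, and in general it bounds the weights of the shifts. *)
Lemma Acoef_shift beta : exists2 c : C, 0 < c &
  forall alpha, c * Acoef P m alpha <= Acoef P m (mnm_add alpha beta).
Proof.
elim/(@mnm_ind n): beta => [|beta j [c c0 IHc]].
  by exists 1 => // alpha; rewrite mul1r addm0.
exists (mcoeff (mnm1 j) (P j) * c); first by rewrite mulr_gt0 ?positive_regular_lin.
move=> alpha; rewrite -mulrA addmA.
apply: (@le_trans _ _ (mcoeff (mnm1 j) (P j) * Acoef P m (mnm_add alpha beta))).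
  by rewrite ler_wpM2l ?P_nneg.
by rewrite Acoef_series; exact: series_coef_step.
Qed.

Lemma Acoef_gt0 alpha : 0 < Acoef P m alpha.
Proof.
have [c c0 /(_ mnm0)] := Acoef_shift alpha.
by rewrite Acoef0 mulr1 add0m; exact: lt_le_trans.
Qed.

Lemma sqrt_Acoef_gt0 alpha : 0 < sqrtC (Acoef P m alpha).
Proof. by rewrite sqrtC_gt0 Acoef_gt0. Qed.

Lemma Acoef_ratio_bounded beta : exists2 M : C, 0 <= M & forall alpha,
  `|sqrtC (Acoef P m alpha) / sqrtC (Acoef P m (mnm_add alpha beta))| <= M.
Proof.
have [c c0 hc] := Acoef_shift beta; exists (sqrtC c^-1).
  by rewrite sqrtC_ge0 invr_ge0 ltW.
move=> alpha; have s1 := sqrt_Acoef_gt0 alpha.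
have s2 := sqrt_Acoef_gt0 (mnm_add alpha beta).
have q0 := divr_gt0 s1 s2.
rewrite (gtr0_norm q0) -(ler_pXn2r (ltn0Sn 1)) ?nnegrE ?(ltW q0) //; last first.
  by rewrite sqrtC_ge0 invr_ge0 ltW.
by rewrite expr_div_n !sqrtCK ler_pdivrMr ?Acoef_gt0 // mulrC ler_pdivlMr // mulrC.
Qed.

End Coefficients.

(** * The multiplication tuple and its joint kernels *)

Section Main.
Context {R : realType} {n : nat}.
Local Notation C := (R[i]%C).
Local Notation V := 'rV[C]_n.
Variables (P : 'I_n -> mpoly n C) (m : 'I_n -> nat).
Hypothesis P_reg : positive_regular P.
Hypothesis m_gt0 : forall j, (0 < m j)%N.
Local Notation A := (Acoef P m).
Local Notation e := (efun P m).
Local Notation D := (triangle P).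
Let P_nneg := positive_regular_nneg P_reg.

Lemma conj_efun alpha w :
  (e alpha w)^* = sqrtC (A alpha) * (monomial (phi w) alpha)^* / (prod_tail w)^*.
Proof.
by rewrite /efun !conjE [(sqrtC _)^*]geC0_conj // ltW // sqrt_Acoef_gt0.
Qed.

Lemma kernel_expansion z w : D z -> D w ->
  has_sum (fun alpha => e alpha z * (e alpha w)^*) (tri_kernel P m z w).
Proof.
move=> [zp zD] [wp wD]; rewrite /tri_kernel.
have -> : \prod_(j < n | (0 < j)%N) (z 0 j * (w 0 j)^*)^-1 = (prod_tail z * (prod_tail w)^*)^-1.
  by rewrite prodfV big_split conj_prod.
have lt1 j : peval (P j) (entrywise_norm (phi2 z w)) < 1.
  apply: le_lt_trans (peval_phi2_le z w (P_nneg j)) _.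
  by rewrite ltr_pdivrMr // mul1r ltrD.
rewrite -/(series_fun P m (phi2 z w)).
apply: eq_has_sum (has_sumZ _ (has_sum_Acoef m P_reg lt1)) => alpha.
rewrite conj_efun /efun monomial_phi2 -{1}(sqrtCK (A alpha)) invfM; ring.
Qed.

Lemma efun_shift alpha j z : D z -> z 0 j * e alpha z =
  sqrtC (A alpha) / sqrtC (A (mnm_add alpha (mnm_tail j))) * e (mnm_add alpha (mnm_tail j)) z.
Proof.
move=> [zp _]; rewrite /efun monomialD monomial_tail -phiK //.
have s0 := lt0r_neq0 (sqrt_Acoef_gt0 P_reg m_gt0 (mnm_add alpha (mnm_tail j))).
have t0 := prod_tail_neq0 zp.
by field; rewrite s0 t0.
Qed.

(** The averaged kernels sit at points that phi sends to [r] times tuples of N-th roots of unity.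
    The coefficient at alpha is then [rho alpha / rho beta] if alpha is congruent to beta, and 0
    otherwise; the squares of these ratios are summable, so [has_sum_alias] bounds by [d] the part
    with alpha different from beta. *)
Lemma isolate_efun beta (d : C) : 0 < d -> exists s : seq (C * {z | D z}),
  kcoef e s beta = 1 /\
  forall F : {fset multinom n}, \sum_(alpha <- F) `|kcoef e s alpha| ^+ 2 <= 1 + d.
Proof.
move=> d0; have [r /andP[r0 r1] hr] := small_polydisc P_nneg (positive_regular_const P_reg).
have rr : r \is Num.real by exact: gtr0_real.
(* At the chosen points the product of phi(w) with its conjugate has all entries [r ^+ 2], so the
   squared coefficients are governed by the series at this [x]. *)
pose x : V := \row_j r ^+ 2.
have xr j : `|x 0 j| <= r.
  by rewrite mxE gtr0_norm ?exprn_gt0 // expr2 -[leRHS]mulr1 ler_pM2l.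
have mx alpha : monomial x alpha = r ^+ mdeg alpha ^+ 2.
  rewrite /monomial mdegE -prodrXr -prodrXl; apply: eq_bigr => j _.
  by rewrite mxE -!exprM mulnC.
pose rho alpha : C := sqrtC (A alpha) * r ^+ mdeg alpha.
have rho0 alpha : 0 < rho alpha by rewrite mulr_gt0 ?sqrt_Acoef_gt0 ?exprn_gt0.
pose b alpha : C := (rho alpha / rho beta) ^+ 2.
have bs : has_sum b ((rho beta ^+ 2)^-1 * series_fun P m x).
  apply: eq_has_sum (has_sumZ _ (has_sum_Acoef m P_reg (hr x xr))) => alpha.
  rewrite mx /b expr_div_n [RHS]mulrC; congr (_ * _).
  by rewrite /rho exprMn sqrtCK.
have [N N0 hN] := has_sum_alias beta bs d0.
have [T [z [z1 zavg]]] := @torus_average R n N N0.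
have rz0 t j : (r *: z t) 0 j != 0.
  by rewrite mxE mulf_neq0 ?(lt0r_neq0 r0) // -normr_eq0 z1 oner_eq0.
pose w t := phi_inv (r *: z t).
have phw t : phi (w t) = r *: z t by rewrite /w phi_invK.
have Dw t : D (w t).
  split=> [|j]; first exact: phi_inv_punctured.
  have -> : phi2 (w t) (w t) = entrywise_norm x; last exact: hr.
  apply/rowP => k; rewrite [LHS]mxE [RHS]mxE [x _ _]mxE phw -normCK mxE normrM z1 mulr1.
  by rewrite normrX.
(* The conjugate of [prod_tail (w t)] cancels the denominator in the conjugate of e_alpha, and
   [rho beta] normalises the coefficient at [beta] to 1. *)
pose c t : C := #|T|%:R^-1 * monomial (z t) beta * (prod_tail (w t))^* / rho beta.
pose s := [seq (c t, exist _ (w t) (Dw t) : {z | D z}) | t <- enum T].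
have Es alpha : kcoef e s alpha = (mnm_eqmod N beta alpha)%:R * (rho alpha / rho beta).
  rewrite /kcoef big_map big_enum /= -[_%:R]conjC_nat -zavg conj_sum mulr_suml.
  apply: eq_bigr => t _; rewrite conj_efun phw monomial_scale !conjE (CrealP rr) conjC_nat /c.
  have t0 : (prod_tail (w t))^* != 0.
    by rewrite fmorph_eq0; apply: prod_tail_neq0; case: (Dw t).
  have T0 : #|T|%:R != 0 :> C by rewrite pnatr_eq0 -lt0n; apply/card_gt0P; exists t.
  have := lt0r_neq0 (rho0 beta); rewrite {3}/rho; move: (rho beta) => q q0.
  by field; rewrite t0 q0 T0.
exists s; split; first by rewrite Es mnm_eqmod_refl divff ?mulr1 // lt0r_neq0.
move=> F; rewrite (bigID (mnm_eqmod N beta)) /= [X in _ + X]big1 => [|alpha /negPf Na].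
  rewrite addr0 (eq_bigr b) => [|alpha Na]; last first.
    by rewrite Es Na mul1r ger0_norm // divr_ge0 // ltW.
  rewrite (bigID (pred1 beta)) /=; apply: lerD; last first.
    apply: le_trans (ltW (hN F)); apply: real_ler_norm.
    by rewrite ger0_real // sumr_ge0 // => alpha _; rewrite exprn_ge0 // divr_ge0 // ltW.
  rewrite (eq_bigl (pred1 beta)) => [|alpha]; last first.
    by rewrite /=; case: eqP => [->|]; rewrite ?andbF ?mnm_eqmod_refl.
  rewrite -big_filter; have [bF|bF] := boolP (beta \in F).
    by rewrite (filter_pred1_uniq (fset_uniq F) bF) big_seq1 /b divff ?expr1n // lt0r_neq0.
  rewrite big1_seq ?ler01 // => alpha; rewrite mem_filter /= => /andP[/eqP ->].
  by rewrite (negPf bF).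
by rewrite Es Na mul0r normr0 expr0n.
Qed.

Context {H : completeNormedModType R[i]%C} {ip : {dot H for Num.conj}}
  {ev : H -> V -> C}.
Hypothesis HK : is_rkhs D (tri_kernel P m) ip ev.
Let ip_hilbert : hilbert ip := rkhs_hilbert HK.
Local Notation E := (ebasis (D := D) (ev := ev) e).
Local Notation mulz := (mulop D ev).

Let ev_E := ev_ebasis HK kernel_expansion.
Let E_total := ebasis_total HK kernel_expansion isolate_efun.
Let E_expansion := ev_expansion HK kernel_expansion isolate_efun.

Lemma ip_kernel_E alpha w : D w ->
  ip (kfun (D := D) (K := tri_kernel P m) (ev := ev) w) (E alpha) = (e alpha w)^*.
Proof. exact: (ip_kfun_ebasis HK kernel_expansion). Qed.

Lemma mulz_bounded j : exists2 M : C, 0 <= M & forall g,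
  (forall z, D z -> ev (mulz j g) z = z 0 j * ev g z) /\ `|mulz j g| <= M * `|g|.
Proof.
have [M M0 hM] := Acoef_ratio_bounded P_reg m_gt0 (mnm_tail j).
exists M => // g; have sigma_inj : injective (mnm_add^~ (mnm_tail j)).
  move=> a b /mnmP ab; apply/mnmP => i; have := ab i.
  by rewrite !mnmDE => /addIn.
have [h hev hb] := weighted_shift_multiplier HK kernel_expansion sigma_inj M0 hM
  (fun alpha z => @efun_shift alpha j z) g.
by rewrite /mulop (eltE HK hev).
Qed.

Lemma mulz_linear j (a : C) f g : mulz j (a *: f + g) = a *: mulz j f + mulz j g.
Proof.
apply: (mulop_linear HK) => h; have [M _ /(_ h)[hM _]] := mulz_bounded j.
by exists (mulz j h).
Qed.

Lemma mulz_adjoint j f g : ip (mulz j g) f = ip g (adjoint ip (mulz j) f).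
Proof.
have [M M0 hM] := mulz_bounded j.
apply: (adjointP ip_hilbert M0 (mulz_linear j)) => h.
by have [] := hM h.
Qed.

Lemma joint_kerP w f :
  joint_ker D ip ev w f <-> forall j g, ip (mulz j g) f = w 0 j * ip g f.
Proof.
split=> [fw j g|fw j _].
  have /eqP := fw j I; rewrite subr_eq0 => /eqP adj.
  by rewrite mulz_adjoint adj ipZr conjCK.
apply/eqP; rewrite subr_eq0; apply/eqP/adjointE => // g.
by rewrite fw ipZr conjCK.
Qed.

Lemma mulz_E j alpha : mulz j (E alpha) =
  (sqrtC (A alpha) / sqrtC (A (mnm_add alpha (mnm_tail j)))) *: E (mnm_add alpha (mnm_tail j)).
Proof.
apply: (eltE HK) => z Dz.
by rewrite (evZ HK) // !ev_E // efun_shift.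
Qed.

(** Division by [sqrtC (A alpha)] removes the weights of the shifts: the eigenvalue equation becomes
    plain multiplication by w_j. *)
Definition normalized_coef f alpha : C := ip (E alpha) f / sqrtC (A alpha).

Lemma normalized_coef_tail w f j alpha : joint_ker D ip ev w f ->
  normalized_coef f (mnm_add alpha (mnm_tail j)) = w 0 j * normalized_coef f alpha.
Proof.
move=> /joint_kerP/(_ j (E alpha)); rewrite mulz_E ipZl /normalized_coef => Ew.
have s0 := lt0r_neq0 (sqrt_Acoef_gt0 P_reg m_gt0 alpha).
by rewrite [RHS]mulrA -Ew; field; rewrite s0 lt0r_neq0 // sqrt_Acoef_gt0.
Qed.

(** Before the last index, eps_j is the tail exponent of j minus that of j + 1, so a step by eps_j
    multiplies by w_j and divides by w_(j+1). This is where w_2, ..., w_n must be nonzero. *)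
Lemma normalized_coef_step w f j alpha : punctured w -> joint_ker D ip ev w f ->
  normalized_coef f (mnm_add alpha (mnm1 j)) = phi w 0 j * normalized_coef f alpha.
Proof.
move=> wp fw; have [[k kj]|jn] := ord_nextP j; last first.
  by rewrite phi_last // -(mnm_tail_last jn) (normalized_coef_tail _ _ fw).
have wk : w 0 k != 0 by apply: wp; rewrite kj.
apply: (mulfI wk); rewrite -(normalized_coef_tail _ _ fw) -addmA -(mnm_tail_next kj).
by rewrite (normalized_coef_tail _ _ fw) (phi_next _ kj); field.
Qed.

Lemma joint_ker_coef w f alpha : punctured w -> joint_ker D ip ev w f ->
  ip f (E alpha) = ip f (E (@mnm0 n)) * (prod_tail w)^* * (e alpha w)^*.
Proof.
move=> wp fw; have L : normalized_coef f alpha = monomial (phi w) alpha * ip (E (@mnm0 n)) f.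
  elim/(@mnm_ind n): alpha => [|alpha j IHalpha].
    by rewrite monomial0 mul1r /normalized_coef Acoef0 // sqrtC1 divr1.
  by rewrite (normalized_coef_step _ _ wp fw) IHalpha monomialD monomial1; ring.
have s0 := lt0r_neq0 (sqrt_Acoef_gt0 P_reg m_gt0 alpha).
have t0 : (prod_tail w)^* != 0 by rewrite fmorph_eq0 prod_tail_neq0.
rewrite [LHS]ipC (_ : ip (E alpha) f = sqrtC (A alpha) * normalized_coef f alpha); last first.
  by rewrite /normalized_coef mulrC divfK.
rewrite L conj_efun !conjE [(sqrtC _)^*]geC0_conj ?ltW ?sqrt_Acoef_gt0 // -[(ip (E mnm0) f)^*]ipC.
by field.
Qed.

Lemma joint_ker_coef0_neq0 w f : punctured w -> joint_ker D ip ev w f -> f != 0 ->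
  ip f (E (@mnm0 n)) != 0.
Proof.
move=> wp fw; apply: contraNneq => f0; apply/eqP/E_total => alpha.
by rewrite (joint_ker_coef _ wp fw) f0 !mul0r.
Qed.

Lemma joint_ker_triangle w : D w -> joint_ker D ip ev w =
  [set eta *: elt D ev (fun z => tri_kernel P m z w) | eta in [set: C]].
Proof.
move=> Dw; rewrite -/(kfun (D := D) (K := tri_kernel P m) (ev := ev) w).
apply/seteqP; split=> [f fw|_ [eta _ <-]].
  (* The kernel at [w] has coefficients conj(e_alpha(w)), and [joint_ker_coef] exhibits those of [f]
     as this multiple of them. *)
  exists (ip f (E (@mnm0 n)) * (prod_tail w)^*) => //.
  apply/esym/eqP; rewrite -subr_eq0; apply/eqP/E_total => alpha.
  by rewrite ipBl ipZl ip_kernel_E // (joint_ker_coef _ _ fw) ?subrr //; case: Dw.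
apply/joint_kerP => j g; rewrite !ipZr -!(reproducing HK) //.
have [M _ /(_ g)[-> // _]] := mulz_bounded j; ring.
Qed.

(** One inclusion uses only the last coordinate: its tail exponent is eps_n, so the coefficient at
    any alpha with alpha_n > 0 carries the factor w_n = 0. Conversely every tail exponent contains
    eps_n, so each z_j e_alpha is orthogonal to an [f] whose coefficients vanish for alpha_n > 0. *)
Lemma joint_ker0 : (0 < n)%N -> joint_ker D ip ev 0 =
  closed_span [set E alpha | alpha in
    [set alpha : multinom n | forall j : 'I_n, j.+1 = n -> alpha j = 0%N]].
Proof.
move=> n0; have [l ln] : exists l : 'I_n, l.+1 = n.
  by case: n n0 => // n' _; exists ord_max.
apply/seteqP; split=> f.
  move=> f0; apply/(closed_span_ebasis HK kernel_expansion isolate_efun) => alpha.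
  move=> /existsNP[j /not_implyP[jn /eqP aj]].
  have Ea : alpha = mnm_add (mnm_sub alpha (mnm1 j)) (mnm_tail j).
    apply/mnmP => i; rewrite mnm_tail_last // mnmDE mnmBE subnK // mnm1E.
    by case: eqP => // <-; rewrite lt0n.
  have := normalized_coef_tail j (mnm_sub alpha (mnm1 j)) f0.
  rewrite -Ea mxE mul0r => /eqP; rewrite mulf_eq0 invr_eq0.
  rewrite [_ || _]orbC gt_eqF ?sqrt_Acoef_gt0 //= => /eqP E0.
  by rewrite ipC E0 conjC0.
move=> /(closed_span_ebasis HK kernel_expansion isolate_efun) f0.
apply/joint_kerP => j g; rewrite mxE mul0r mulz_adjoint.
suff -> : adjoint ip (mulz j) f = 0 by rewrite ip0r.
apply: E_total => alpha; rewrite ipC -mulz_adjoint mulz_E ipZl ipC f0 ?conjC0 ?mulr0 ?conjC0 //.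
move=> /(_ l ln) /eqP; rewrite mnmDE addn_eq0 => /andP[_].
by apply/negP/mnm_tail_at; rewrite -ltnS ln.
Qed.

(** As [w] may lie outside the triangle, convergence has to come from [f]: the terms are those of
    the expansion of [f] divided by [c], which is nonzero when [f] is. For [f = 0] both sides
    vanish, whatever value [sum] takes. *)
Lemma joint_ker_formula w f z : punctured w -> joint_ker D ip ev w f -> D z ->
  let terms alpha : C^o := (e alpha w)^* * e alpha z in
  (f != 0 -> cvg (partial_sum terms @ totally)) /\
  ev f z = ip f (E (@mnm0 n)) * (\prod_(k < n | (0 < k)%N) (w 0 k)^*) * sum terms.
Proof.
move=> wp fw Dz terms; have [->|f0] := eqVneq f 0.
  by split=> //; rewrite (ev0 HK Dz) ip0l !mul0r.
rewrite -conj_prod -/(prod_tail w); set c := _ * (_)^*.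
have c0 : c != 0.
  by rewrite mulf_neq0 ?(joint_ker_coef0_neq0 wp fw f0) // fmorph_eq0 prod_tail_neq0.
have hs : has_sum terms (c^-1 * ev f z).
  apply: eq_has_sum (has_sumZ c^-1 (E_expansion f Dz)) => alpha.
  rewrite (joint_ker_coef _ wp fw) -/c /terms.
  by rewrite -[c * _ * _]mulrA mulKf.
have /has_sumP terms_cvg := hs; split=> [_|].
  by apply/cvg_ex; exists (c^-1 * ev f z).
rewrite /sum (cvg_lim _ terms_cvg) //; by rewrite mulrA divff // mul1r.
Qed.

End Main.

Theorem lemma6p2 (R : realType) (n : nat) (n_ge2 : (2 <= n)%N)
  (P : 'I_n -> mpoly n R[i]%C) (P_reg : positive_regular P)
  (m : 'I_n -> nat) (m_gt0 : forall j, (0 < m j)%N)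
  (H : completeNormedModType R[i]%C) (ip : {dot H for Num.conj})
  (ev : H -> 'rV[R[i]%C]_n -> R[i]%C)
  (H_rkhs : is_rkhs (triangle P) (tri_kernel P m) ip ev) :
  let D := triangle P in
  let e alpha := elt D ev (efun P m alpha) in
  [/\ forall w, D w ->
        joint_ker D ip ev w =
        [set eta *: elt D ev (fun z => tri_kernel P m z w) | eta in [set: R[i]%C]],
      joint_ker D ip ev 0 =
        closed_span [set e alpha | alpha in
          [set alpha : multinom n | forall j : 'I_n, j.+1 = n -> alpha j = 0%N]] &
      forall w, punctured w -> forall f, joint_ker D ip ev w f ->
      forall z, D z ->
        let terms alpha : R[i]%C^o := (efun P m alpha w)^* * efun P m alpha z in
        (f != 0 -> cvg (partial_sum terms @ totally)) /\
        ev f z = ip f (e mnm0) * (\prod_(k < n | (0 < k)%N) (w 0 k)^*) *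
                 sum terms].
Proof.
move=> D e; split.
- by move=> w; exact: (joint_ker_triangle P_reg m_gt0 H_rkhs).
- exact: (joint_ker0 P_reg m_gt0 H_rkhs (ltnW n_ge2)).
- move=> w wp f fw z Dz.
  exact: (joint_ker_formula P_reg m_gt0 H_rkhs wp fw Dz).
Qed.
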